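(* Let $d$ be a prime. Let $\zeta\neq 1$ be a $d$-th root of unity, and let $c_0\in\mathbb{C}$ be a root of $G_{d,m,n}^{\zeta}$ for some integers $m \geq 2$, $n \geq 1$. Set $K = \mathbb{Q}(c_0)$, and suppose that $\alpha \in K$ satisfies $v_{\mathfrak{p}}(\alpha) \geq 2$ for some prime $\mathfrak{p} \subset \mathcal{O}_K$ above $d$. Then the pair $(f_{d,c_0}, \alpha)$ is stable over $K$.
   Context: For a prime $d$ and $c_0\in\mathbb{C}$, $f_{d,c_0}=x^d+c_0$. For a polynomial $f$, $f^n$ denotes the $n$-th iterate: $f^0=x$, $f^n=f\circ f^{n-1}$ for $n\ge 1$. Define polynomials $a_i=a_i(c)\in\mathbb{Z}[c]$ (depending on $d$) by $a_1=c$ and $a_{i+1}=a_i^d+c$ for $i\ge 1$; thus $a_i(c_0)=f_{d,c_0}^i(0)$. For a $d$-th root of unity $\zeta\neq 1$ and integers $m\ge 2$, $n\ge 1$, the monic polynomial $G_{d,m,n}^{\zeta}(c)\in\mathbb{Z}[\zeta][c]$ is defined by $$G_{d,m,n}^{\zeta}(c) := \prod_{k \mid n} \big( a_{m+k-1} - \zeta a_{m-1} \big)^{\mu(n/k)}\cdot \begin{cases}\prod_{k \mid n} \big( a_k \big)^{-\mu(n/k)} & \text{if } n \mid (m-1),\\ 1 & \text{if } n \nmid (m-1),\end{cases}$$ where $\mu$ is the Möbius function. (Its roots are the Misiurewicz parameters of type $(m,n)$ for $\zeta$.) $\mathcal{O}_K$ is the ring of integers of $K$, and $v_{\mathfrak{p}}$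 is the normalized $\mathfrak{p}$-adic valuation on $K$, with $v_{\mathfrak p}(0)=\infty$. For a field $K$, $\alpha\in K$ and $f\in K[x]$ of degree at least $2$, the pair $(f,\alpha)$ is stable over $K$ if $f^n-\alpha$ is irreducible over $K$ for all $n\ge 1$. *)

(* Defs.v *)
From HB Require Import structures.
From mathcomp Require Import all_boot all_order all_algebra all_field.
From mathcomp Require Import boolp classical_sets reals constructive_ereal.
From mathcomp Require Import complex.

Set Implicit Arguments.
Unset Strict Implicit.
Unset Printing Implicit Defensive.

Import Order.TTheory GRing.Theory Num.Theory.

Local Open Scope ring_scope.

Definition moebius (n : nat) : int :=
  if all (fun p => logn p n == 1)%N (primes n)
  then (-1) ^+ size (primes n) else 0.

Section Dynamics.
Variable F : fieldType.

Definition unicritical (d : nat) (c : F) : {poly F} := 'X^d + c%:P.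

Definition iter_poly (f : {poly F}) (n : nat) : {poly F} :=
  iter n (fun g => f \Po g) 'X.

Definition stable (f : {poly F}) (alpha : F) : Prop :=
  forall n, (1 <= n)%N -> irreducible_poly (iter_poly f n - alpha%:P).

(* For i >= 1 this is a_i, with the indeterminate 'X in the role of the
   parameter c; the value at i = 0 is a dummy. *)
Definition crit_orbit (d i : nat) : {poly F} :=
  iter i.-1 (fun a => a ^+ d + 'X) 'X.

Definition misiurewicz_frac (d m n : nat) (zeta : F) : {fraction {poly F}} :=
  (\prod_(k <- divisors n)
      (FracField.tofrac (crit_orbit d (m + k - 1)%N
                         - zeta *: crit_orbit d (m - 1)%N))
        ^ moebius (n %/ k)%N)
  * (if (n %| m - 1)%N then
       \prod_(k <- divisors n)
          (FracField.tofrac (crit_orbit d k)) ^ (- moebius (n %/ k)%N)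
     else 1).

(* The polynomial part of a rational function: the quotient of a numerator
   by a denominator, which does not depend on the chosen representative and
   is inverse to the embedding of polynomials into rational functions. *)
Definition poly_part (x : {fraction {poly F}}) : {poly F} :=
  (\n_(repr x) %/ \d_(repr x))%R.

Lemma poly_part_tofrac (p : {poly F}) : poly_part (FracField.tofrac p) = p.
Proof.
have dn0 : \d_(repr (FracField.tofrac p)) != 0 by apply: denom_ratioP.
have := FracField.equivf_l (Ratio p 1).
have -> : (\pi_({fraction {poly F}}) (Ratio p 1))%qT = FracField.tofrac p.
  by rewrite /FracField.tofrac; unlock.
rewrite !numden_Ratio ?oner_eq0 // mulr1 => e.
by rewrite /poly_part e mulrC mulpK.
Qed.

(* misiurewicz_frac is a monic polynomial with coefficients in Z[zeta], so
   that no information is lost by taking the polynomial part. *)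
Definition misiurewicz_poly (d m n : nat) (zeta : F) : {poly F} :=
  poly_part (misiurewicz_frac d m n zeta).

End Dynamics.

Section RingOfIntegers.
Variable K : fieldExtType rat.

Definition algebraic_integer : {pred K} :=
  fun x => `[< integralOver (intr : int -> K) x >].

Fact algebraic_integer_subring : subring_closed algebraic_integer.
Proof.
split=> [|x y|x y]; rewrite -!topredE /= /algebraic_integer.
- exact/asboolP/integral1.
- by move=> /asboolP ix /asboolP iy; apply/asboolP/integral_sub.
- by move=> /asboolP ix /asboolP iy; apply/asboolP/integral_mul.
Qed.

HB.instance Definition _ :=
  GRing.isSubringClosed.Build K algebraic_integer algebraic_integer_subring.

Definition ring_of_integers : Type := {x : K | x \in algebraic_integer}.

HB.instance Definition _ := [isSub of ring_of_integers for @sval _ _].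
HB.instance Definition _ := [Choice of ring_of_integers by <:].
HB.instance Definition _ :=
  [SubChoice_isSubComNzRing of ring_of_integers by <:].

End RingOfIntegers.

Section IdealPowers.
Variable A : comNzRingType.
Local Open Scope classical_set_scope.

Definition ideal_mul (I J : set A) : set A :=
  [set x | exists2 s : seq (A * A),
     (forall y, y \in s -> I y.1 /\ J y.2) & x = \sum_(y <- s) y.1 * y.2].

Definition ideal_exp (I : set A) (n : nat) : set A :=
  iter n (ideal_mul I) setT.

Definition ideal_ord (I : set A) (x : A) (k : nat) : Prop :=
  ideal_exp I k x /\ ~ ideal_exp I k.+1 x.

End IdealPowers.

Section Valuation.
Variables (K : fieldExtType rat) (p : prime_idealr (ring_of_integers K)).

(* For a nonzero prime p and alpha != 0, the unique such e is the exponent of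
   p in the factorization of the fractional ideal generated by alpha. *)
Definition fractional_ord (alpha : K) (e : int) : Prop :=
  exists x y : ring_of_integers K, exists i j : nat,
    [/\ alpha = val x / val y,
        ideal_ord [set` p]%classic x i, ideal_ord [set` p]%classic y j
      & e = i%:Z - j%:Z].

Definition valuation (alpha : K) : \bar int :=
  if alpha == 0 then +oo%E else (xget 0 (fractional_ord alpha))%:E.

End Valuation.

(* Main.v *)
Require Import Defs.
From HB Require Import structures.
From mathcomp Require Import all_boot all_order all_algebra all_field.
From mathcomp Require Import boolp classical_sets reals constructive_ereal.
From mathcomp Require Import complex.
From mathcomp Require Import ring zify.

Set Implicit Arguments.
Unset Strict Implicit.
Unset Printing Implicit Defensive.

Import Order.TTheory GRing.Theory Num.Theory.
Local Open Scope ring_scope.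

(** Write [a_i] for the value at [0] of the [i]-th iterate of [x ^ d + c].

    Over the complex numbers the root condition on the Misiurewicz polynomial
    only serves to obtain [a_(m+n-1) = zeta a_(m-1)] with [a_(m-1) <> 0].  The
    derivatives of the polynomials [a_i] are [1] modulo [d], so all factors in
    the defining product have simple roots ([crit_val_derivative_neq0] and
    [crit_val_twisted_simple]).  At a given point the factors that vanish are
    those whose index is a multiple of some integer, so by Moebius inversion the
    order of the product is [0] or [1], and it is [0] at the points where
    [a_(m-1)] vanishes ([misiurewicz_poly_root]).

    In the field [K] generated by [c], let [A] be the localization of [Z[c]] at
    its prime below [p], and let [r] be the least positive integer for which
    [a_r] is not a unit of [A].  The map [x ^ d + c] contracts distances inside
      a
    residue class, so the orbit of [0] has period [r] from [a_m] on, and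
    comparing differences of orbit points with [zeta - 1] shows that [a_r]
    divides [d] and that [d] divides a power of [a_r] ([local_uniformizer]).  As
    [a_r] is separable modulo [d], it generates the maximal ideal of [A]; and as
    every nonzero element of [Z[c]] divides a nonzero integer, hence up to a
      unit
    a power of [d], it divides a power of [a_r].  Thus [A] is a discrete
    valuation ring with uniformizer [a_r], it contains the integers of [K], and
    its valuation is the one defined by the powers of [p] ([ord_unif_val]).

    For every multiple [l] of [r], [a_l] is [a_r] up to a unit, while [alpha]
      has
    valuation at least [2].  Modulo [d] the [l]-th iterate is
    [x ^ (d ^ l) + a_l].  So the [l]-th iterate minus [alpha] is an Eisenstein
    polynomial ([iterate_eisenstein]).  Every iterate is the outer part of a
    composition giving one of these, which makes all of them irreducible minus
    [alpha] ([irreducible_comp]). *)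

(** * Divisibility and integrality relative to a subring of a field *)

Section Multiples.
Variables (F : fieldType) (S : subringClosed F).
Implicit Types (a t x : F).

Definition multiple_of t : {pred F} := fun x => x / t \in S.

Fact multiple_of_zmod_closed t : zmod_closed (multiple_of t).
Proof.
have E x : (x \in multiple_of t) = (x / t \in S) by [].
split=> [|x y]; rewrite !E; first by rewrite mul0r rpred0.
by move=> xt yt; rewrite mulrBl rpredB.
Qed.

HB.instance Definition _ t :=
  GRing.isZmodClosed.Build F (multiple_of t) (multiple_of_zmod_closed t).

Lemma multipleE t x : (x \in multiple_of t) = (x / t \in S).
Proof. by []. Qed.

Lemma multiple_mull t a x :
  a \in S -> x \in multiple_of t -> a * x \in multiple_of t.
Proof. by rewrite !multipleE -mulrA; apply: rpredM. Qed.

Lemma multiple_mulr t a x :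
  a \in S -> x \in multiple_of t -> x * a \in multiple_of t.
Proof. by rewrite mulrC; apply: multiple_mull. Qed.

Lemma multiple_refl t : t != 0 -> t \in multiple_of t.
Proof. by rewrite multipleE => t0; rewrite divff // rpred1. Qed.

Lemma multipleP t x : t != 0 ->
  reflect (exists2 y, y \in S & x = t * y) (x \in multiple_of t).
Proof.
move=> t0; rewrite multipleE; apply: (iffP idP) => [xt|[y yS ->]].
  by exists (x / t) => //; rewrite mulrC divfK.
by rewrite mulrC mulrA mulVf // mul1r.
Qed.

(** Multiplying the monic equation of [x] by a power of [x^-1] expresses [x]
    as an integral polynomial in [x^-1]. *)
Lemma integral_mem_inv x : integralOver (intr : int -> F) x ->
  x^-1 \in S -> x \in S.
Proof.
have [->|x0] := eqVneq x 0; first by rewrite rpred0.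
move=> [p p_monic /rootP px0] VxS.
have [n sz_p] : exists n, size p = n.+2.
  have: size p != 0 by rewrite size_poly_eq0 monic_neq0.
  have: size p != 1.
    apply/eqP => /eqP/size_poly1P[a a0 pE].
    by move: px0; rewrite pE map_polyC hornerC => /eqP; move: p_monic;
      rewrite pE monicE lead_coefC => /eqP->; rewrite oner_eq0.
  by case: (size p) => [|[|n]] // _ _; exists n.
have sz_pF : size (map_poly (intr : int -> F) p) = n.+2.
  by rewrite size_map_poly_id0 // (eqP p_monic) oner_neq0.
move: px0; rewrite horner_coef sz_pF big_ord_recr /= coef_map /=.
have -> : p`_n.+1 = 1 by rewrite -(eqP p_monic) lead_coefE sz_p.
rewrite mul1r addrC => /eqP; rewrite addr_eq0 => /eqP xE.
have -> : x = x ^+ n.+1 * x^-1 ^+ n.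
  by rewrite exprS -mulrA -exprMn divff // expr1n mulr1.
rewrite xE mulNr rpredN mulr_suml rpred_sum // => i _.
rewrite coef_map /= -mulrA rpredM ?rpred_int //.
have le_in : (i <= n)%N by rewrite -ltnS.
rewrite -[in X in _ * X](subnKC le_in) exprD mulrA -exprMn divff // expr1n
  mul1r.
by rewrite rpredX.
Qed.

End Multiples.

Arguments multipleP {F S t x}.

Section IntegralElements.
Variable F : fieldType.

Definition integral_elt : {pred F} :=
  fun x => `[< integralOver (intr : int -> F) x >].

Lemma integral_eltP x :
  reflect (integralOver (intr : int -> F) x) (x \in integral_elt).
Proof. exact: asboolP. Qed.

Fact integral_elt_subring : subring_closed integral_elt.
Proof.
split=> [|x y /integral_eltP ix /integral_eltP iy|x y /integral_eltP ix
         /integral_eltP iy]; apply/integral_eltP.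
- exact: integral1.
- exact: integral_sub.
- exact: integral_mul.
Qed.

HB.instance Definition _ :=
  GRing.isSubringClosed.Build F integral_elt integral_elt_subring.

End IntegralElements.

Arguments integral_elt {F}.

Section RmorphismImage.
Variables (R S : comNzRingType) (f : {rmorphism R -> S}).

Definition rmorph_image : {pred S} := fun y => `[< exists x, y = f x >].

Lemma rmorph_imageP y : reflect (exists x, y = f x) (y \in rmorph_image).
Proof. exact: asboolP. Qed.

Fact rmorph_image_subring : subring_closed rmorph_image.
Proof.
split=> [|_ _ /rmorph_imageP[x ->] /rmorph_imageP[y ->]
         |_ _ /rmorph_imageP[x ->] /rmorph_imageP[y ->]]; apply/rmorph_imageP.
- by exists 1; rewrite rmorph1.
- by exists (x - y); rewrite rmorphB.
- by exists (x * y); rewrite rmorphM.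
Qed.

HB.instance Definition _ :=
  GRing.isSubringClosed.Build S rmorph_image rmorph_image_subring.

End RmorphismImage.

Lemma nat_inv_not_integral (F : numFieldType) (d : nat) : (1 < d)%N ->
  (d%:R^-1 : F) \notin integral_elt.
Proof.
move=> d_gt1; apply/negP => /integral_eltP di.
have : (d%:R^-1 : F) \in rmorph_image intr.
  by apply: integral_mem_inv di _; rewrite invrK rpred_nat.
move=> /rmorph_imageP[z zE].
have d0 : (d%:R : F) != 0 by rewrite pnatr_eq0; case: d d_gt1 {zE di}.
have : (d%:Z * z)%:~R = 1 :> F by rewrite intrM -zE -pmulrn divff.
move/eqP; rewrite (eqr_int F (d%:Z * z) 1) => /eqP dz.
have : (d %| 1)%N by have := dvdz_mulr z (dvdzz d%:Z); rewrite dz.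
by rewrite dvdn1 => /eqP dE; rewrite dE in d_gt1.
Qed.

(** * The binomial expansion modulo a prime *)

(** Besides the congruence modulo [d], the cross terms are kept to first order
    in [y]: this is what measures the size of [zeta - 1] later on. *)
Lemma exprD_prime (R : comNzRingType) (S : subringClosed R) (d : nat)
    (x y : R) : prime d -> x \in S -> y \in S ->
  exists2 w, w \in S &
    (x + y) ^+ d = x ^+ d + y ^+ d + d%:R * (x * y * (x ^+ d.-2 + y * w)).
Proof.
case: d => [|[|e]] // d_pr xS yS.
have bump0 i : bump 0 i = i.+1 by [].
pose b i := ('C(e.+2, i) %/ e.+2)%N.
exists (\sum_(i < e) x ^+ (e - i.+1) * y ^+ i *+ b i.+2).
  by rewrite rpred_sum // => i _; rewrite rpredMn // rpredM ?rpredX.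
rewrite exprDn big_ord_recl big_ord_recr big_ord_recl /=.
rewrite subn0 expr0 mulr1 bin0 mulr1n subnn expr0 mul1r binn mulr1n.
rewrite -[in RHS]addrA; congr (_ + _).
rewrite [LHS]addrC bump0; congr (_ + _).
rewrite mulrDr mulrDr; congr (_ + _).
  rewrite !bump0 subSS subn0 expr1 bin1 [in RHS]mulr_natl exprS /=.
  by rewrite mulrAC.
rewrite !mulr_sumr; apply: eq_bigr => i _.
rewrite !bump0 !subSS.
have lt_ie := ltn_ord i.
have -> : 'C(e.+2, i.+2) = (b i.+2 * e.+2)%N.
  by rewrite /b divnK // prime_dvd_bin.
rewrite mulrnA -[LHS]mulr_natl -mulrnAr; congr (_ * _).
by rewrite (_ : (e - i = (e - i.+1).+1)%N) ?exprS; [ring | lia].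
Qed.

Corollary exprD_prime_mod (R : comNzRingType) (S : subringClosed R) (d : nat)
    (x y : R) : prime d -> x \in S -> y \in S ->
  exists2 w, w \in S & (x + y) ^+ d = x ^+ d + y ^+ d + d%:R * w.
Proof.
move=> d_pr xS yS; have [w wS ->] := exprD_prime d_pr xS yS.
exists (x * y * (x ^+ d.-2 + y * w)) => //.
by rewrite !rpredM // rpredD ?rpredX // rpredM.
Qed.

(** * The critical orbit as a function of the parameter *)

(** The value at [0] of the [i]-th iterate of [x ^ d + c], in any ring and for
    every [i], so that [i = 0] gives the critical point itself. *)
Definition crit_val (R : comNzRingType) (d : nat) (c : R) (i : nat) : R :=
  iter i (fun y => y ^+ d + c) 0.

Section CritVal.
Variable d : nat.
Implicit Types R : comNzRingType.

Lemma crit_valS R (c : R) i : crit_val d c i.+1 = crit_val d c i ^+ d + c.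
Proof. by []. Qed.

Lemma crit_val1 R (c : R) : (0 < d)%N -> crit_val d c 1 = c.
Proof. by move=> d0; rewrite crit_valS expr0n gtn_eqF // add0r. Qed.

Lemma crit_val_rmorph R R' (f : {rmorphism R -> R'}) c i :
  f (crit_val d c i) = crit_val d (f c) i.
Proof.
elim: i => [|i IH]; first exact: rmorph0.
by rewrite !crit_valS rmorphD rmorphXn /= IH.
Qed.

Lemma crit_val_mem R (S : subringClosed R) c i :
  c \in S -> crit_val d c i \in S.
Proof.
by move=> cS; elim: i => [|i IH]; rewrite ?rpred0 // crit_valS rpredD ?rpredX.
Qed.

Lemma crit_val_shift R (c : R) i j k : crit_val d c i = crit_val d c j ->
  crit_val d c (i + k) = crit_val d c (j + k).
Proof.
by move=> eq_ij; elim: k => [|k IH]; rewrite ?addn0 // !addnS !crit_valS IH.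
Qed.

Lemma crit_valD0 R (c : R) i k : crit_val d c i = 0 ->
  crit_val d c (i + k) = crit_val d c k.
Proof. by move=> i0; apply: (@crit_val_shift _ _ i 0). Qed.

Lemma crit_val_horner R (x : R) i : (crit_val d 'X i).[x] = crit_val d x i.
Proof.
by rewrite -[LHS]/(horner_eval x _) crit_val_rmorph /= /horner_eval hornerX.
Qed.

Lemma crit_orbitE (F : fieldType) i : (0 < d)%N -> (0 < i)%N ->
  crit_orbit F d i = crit_val d 'X i.
Proof.
by case: i => // i d0 _;
  rewrite /crit_orbit /crit_val iterSr expr0n gtn_eqF // add0r.
Qed.

Lemma size_crit_val (R : idomainType) i : (1 < d)%N ->
  size (crit_val d ('X : {poly R}) i.+1) = (d ^ i).+1 /\
  crit_val d ('X : {poly R}) i.+1 \is monic.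
Proof.
move=> d_gt1; elim: i => [|i [IHsz IHm]].
  by rewrite crit_val1 ?(ltnW d_gt1) // size_polyX monicX.
have sz_exp : size (crit_val d ('X : {poly R}) i.+1 ^+ d) = (d ^ i.+1).+1.
  rewrite -[LHS]prednK ?size_exp ?IHsz ?expnSr //.
  by rewrite lt0n size_poly_eq0 monic_neq0 ?monic_exp.
have lt_sz : (size ('X : {poly R}) < size (crit_val d ('X : {poly R}) i.+1 ^+
  d))%N.
  by rewrite size_polyX sz_exp ltnS -[ltnLHS](exp1n i.+1) ltn_exp2r.
rewrite crit_valS; split; first by rewrite size_polyDl.
by rewrite monicE lead_coefDl // -monicE monic_exp.
Qed.

(** The relation is a monic integral equation for the parameter, since the
    degrees of the polynomials [a_i] increase with [i]. *)
Lemma preperiodic_integral (F : fieldType) (x : F) i k : (1 < d)%N -> (0 < k)%N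
  ->
  crit_val d x (i + k) = crit_val d x i -> x \in integral_elt.
Proof.
move=> d_gt1; case: k => // k _ eq_x; apply/integral_eltP.
pose a j : {poly int} := crit_val d 'X j.
exists (a (i + k.+1)%N - a i).
  have lt_sz : (size (- a i) < size (a (i + k.+1)))%N.
    rewrite size_polyN /a addnS (size_crit_val _ _ d_gt1).1.
    case: i {eq_x} => [|i]; first by rewrite size_poly0.
    rewrite (size_crit_val _ _ d_gt1).1 ltnS ltn_exp2l //; lia.
  by rewrite monicE lead_coefDl // -monicE /a addnS (size_crit_val _ _ d_gt1).2.
rewrite /root rmorphB hornerD hornerN /a !crit_val_rmorph /= map_polyX.
by rewrite !crit_val_horner eq_x subrr.
Qed.

(** Modulo [d] the polynomial [a_i] has derivative [1]: this is where all
    simplicity statements come from. *)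
Lemma deriv_crit_val R i :
  (crit_val d ('X : {poly R}) i.+1)^`() =
    1 + d%:R * (crit_val d 'X i ^+ d.-1 * (crit_val d 'X i)^`()).
Proof.
by rewrite crit_valS derivD derivX deriv_exp addrC mulr_natl mulrC.
Qed.

End CritVal.

(** * The parameters solving [a_(m+k-1) = zeta a_(m-1)] are simple *)

(** The equation of [zeta - 1], to first order at its constant term [d]. *)
Lemma root_unity_sub1 (F : fieldType) (S : subringClosed F) (d : nat) (t : F) :
  prime d -> t \in S -> t != 0 -> (1 + t) ^+ d = 1 ->
  exists2 w, w \in S & t ^+ d.-1 + d%:R * (1 + t * w) = 0.
Proof.
move=> d_pr tS t0 tE; have [w wS eq_w] := exprD_prime d_pr (rpred1 S) tS.
exists w => //; apply: (mulfI t0).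
have tdE : t ^+ d = t * t ^+ d.-1 by rewrite -exprS prednK ?prime_gt0.
move: eq_w; rewrite tE !expr1n mul1r tdE => eq_w.
by rewrite mulr0; apply: (addrI 1); rewrite addr0 [RHS]eq_w; ring.
Qed.

Section Simplicity.
Variables (F : numFieldType) (d : nat) (zeta x : F).
Hypotheses (d_prime : prime d) (zeta_root : zeta ^+ d = 1).
Hypotheses (zeta_neq1 : zeta != 1) (x_int : x \in integral_elt).

Let a i := crit_val d x i.
Let D i := (crit_val d 'X i)^`().[x].

Let aS i : a i \in integral_elt. Proof. exact: crit_val_mem. Qed.

Let d_gt1 : (1 < d)%N. Proof. exact: prime_gt1. Qed.

Let DS i : D i \in integral_elt.
Proof.
rewrite /D; case: i => [|i]; first by rewrite derivC horner0 rpred0.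
elim: i => [|i IH].
  rewrite deriv_crit_val derivC !mulr0 addr0 hornerC rpred1 //.
rewrite deriv_crit_val hornerD hornerC !hornerM horner_exp crit_val_horner.
by rewrite -polyC_natr hornerC rpredD ?rpredM ?rpredX ?rpred_nat ?rpred1.
Qed.

Let D_S i : D i.+1 = 1 + d%:R * (a i ^+ d.-1 * D i).
Proof.
rewrite /D deriv_crit_val hornerD hornerC !hornerM horner_exp crit_val_horner.
by rewrite -polyC_natr hornerC.
Qed.

Let aD i : exists2 e, e \in integral_elt & a i ^+ d.-1 * D i = a i ^+ d.-1 +
  d%:R * e.
Proof.
case: i => [|i].
  exists 0; rewrite ?rpred0 // /a expr0n gtn_eqF ?mul0r ?mulr0 ?addr0 //.
  by rewrite -subn1 subn_gt0.
exists (a i.+1 ^+ d.-1 * (a i ^+ d.-1 * D i)).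
  by rewrite !rpredM ?rpredX.
by rewrite D_S; ring.
Qed.

Lemma crit_val_derivative_neq0 i : (0 < i)%N ->
  (crit_val d 'X i)^`().[x] != 0.
Proof.
case: i => // i _; apply/eqP; rewrite -/(D i.+1) D_S => /eqP.
rewrite addrC addr_eq0 => /eqP dE.
have d0 : (d%:R : F) != 0 by rewrite pnatr_eq0 -lt0n prime_gt0.
have /negP[] := nat_inv_not_integral F d_gt1.
have -> : d%:R^-1 = - (a i ^+ d.-1 * D i).
  by apply: (mulfI d0); rewrite divff // mulrN dE opprK.
by rewrite rpredN rpredM ?rpredX.
Qed.

(** If the derivative vanished, [zeta - 1] would be [d] times a number [w0],
    whose [d]-th power is a multiple of [zeta - 1] because the [d]-th power map
    is additive modulo [zeta - 1].  As [zeta - 1] divides [d], this would make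
    [w0], hence [zeta - 1], hence [d], invertible. *)
Lemma crit_val_twisted_simple i k : a (i + k).+1 = zeta * a i.+1 ->
  (crit_val d 'X (i + k).+1 - zeta *: crit_val d 'X i.+1)^`().[x] != 0.
Proof.
move=> a_eq; rewrite derivB derivZ hornerD hornerN hornerZ -!/(D _).
apply/eqP; rewrite !D_S => D_eq.
have d0 : (d%:R : F) != 0 by rewrite pnatr_eq0 -lt0n prime_gt0.
have zS : zeta \in integral_elt.
  apply/integral_eltP; exists ('X^d - 1).
    by rewrite monicE lead_coefDl ?lead_coefXn // size_polyN size_poly1
      size_polyXn ltnS prime_gt0.
  by rewrite /root rmorphB rmorph1 /= map_polyXn !hornerE zeta_root subrr.
pose t := zeta - 1.
have zE : zeta = 1 + t by rewrite /t addrC subrK.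
have t0 : t != 0 by rewrite subr_eq0.
have tS : t \in integral_elt by rewrite rpredB ?rpred1.
have zd : (1 + t) ^+ d = 1 by rewrite -zE.
have [w wS w_eq] := root_unity_sub1 d_prime tS t0 zd.
pose v := - (t ^+ d.-2 + w * d%:R).
have vS : v \in integral_elt.
  by rewrite rpredN rpredD ?rpredX // rpredM ?rpred_nat.
have dE : d%:R = t * v.
  have tdE : t ^+ d.-1 = t * t ^+ d.-2.
    by rewrite -exprS; congr (_ ^+ _); move: d_gt1; lia.
  by apply: subr0_eq; rewrite -w_eq tdE /v; ring.
pose w0 := a (i + k) ^+ d.-1 * D (i + k) - zeta * (a i ^+ d.-1 * D i).
have w0S : w0 \in integral_elt by rewrite rpredB ?rpredM ?rpredX.
have tE : t = d%:R * w0 by apply: subr0_eq; rewrite -oppr0 -D_eq /w0 zE; ring.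
have vw0 : v * w0 = 1 by apply: (mulfI t0); rewrite mulrA -dE -tE mulr1.
have d_t : d%:R \in multiple_of integral_elt t by apply/(multipleP t0);
  exists v.
have t_t := multiple_refl integral_elt t0.
pose e := a (i + k) - a i.
have eS : e \in integral_elt by rewrite rpredB.
have ed_t : e ^+ d \in multiple_of integral_elt t.
  have [y yS y_eq] := exprD_prime d_prime (aS i) eS.
  have -> : e ^+ d = t * a i.+1 - d%:R * (a i * e * (a i ^+ d.-2 + e * y)).
    have -> : t * a i.+1 = a (i + k) ^+ d - a i ^+ d.
      by rewrite mulrBl mul1r -a_eq /a !crit_valS; ring.
    have -> : a (i + k) = a i + e by rewrite /e addrC subrK.
    by rewrite y_eq; ring.
  rewrite rpredB ?multiple_mulr // !rpredM // rpredD ?rpredX ?rpredM //.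
have [e1 e1S a1] := aD (i + k); have [e2 e2S a2] := aD i.
have [q qS q_eq] : exists2 q, q \in integral_elt &
    a (i + k) ^+ d.-1 - a i ^+ d.-1 = e * q.
  rewrite subrXX; eexists; last by [].
  by rewrite rpred_sum // => j _; rewrite rpredM ?rpredX.
pose r := v * e1 - zeta * v * e2 - a i ^+ d.-1.
have rS : r \in integral_elt by rewrite !rpredB ?rpredM ?rpredX.
have w0E : w0 = e * q + t * r.
  by rewrite /w0 a1 a2 mulrDr -q_eq /r dE zE; ring.
have w0d_t : w0 ^+ d \in multiple_of integral_elt t.
  have eqS : e * q \in integral_elt by rewrite rpredM.
  have trS : t * r \in integral_elt by rewrite rpredM.
  rewrite w0E; have [y yS ->] := exprD_prime_mod d_prime eqS trS.
  rewrite !rpredD // ?exprMn ?multiple_mulr ?rpredX //.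
  by rewrite -(prednK (prime_gt0 d_prime)) exprS multiple_mulr ?rpredX.
have Vt : t^-1 \in integral_elt.
  rewrite -div1r -multipleE -(expr1n _ d) -vw0 exprMn.
  by rewrite multiple_mull ?rpredX.
have /negP[] := nat_inv_not_integral F d_gt1.
have -> : d%:R^-1 = - ((1 + t * w) * t^-1 ^+ d.-1).
  apply: (mulfI d0); rewrite divff // mulrN mulrA.
  move/eqP: w_eq; rewrite addrC addr_eq0 => /eqP->.
  by rewrite mulNr opprK -exprMn divff // expr1n.
by rewrite rpredN rpredM ?rpredX // rpredD ?rpred1 // rpredM.
Qed.

End Simplicity.

(** * Moebius inversion *)

Lemma moebius_prime_mul (q e : nat) : prime q -> (0 < e)%N -> ~~ (q %| e)%N ->
  moebius (q * e) = - moebius e.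
Proof.
move=> q_pr e0 nqe.
have q_notin : q \notin primes e by rewrite mem_primes (negPf nqe) !andbF.
have eq_primes : perm_eq (primes (q * e)) (q :: primes e).
  apply: uniq_perm; rewrite ?primes_uniq //= ?q_notin ?primes_uniq // => p.
  by rewrite primesM ?(prime_gt0 q_pr) // primes_prime // mem_seq1 inE.
have logn_e p : p \in primes e -> logn p (q * e) = logn p e.
  move=> pe; rewrite lognM ?(prime_gt0 q_pr) // logn_prime //.
  by case: eqVneq pe q_notin => [->|] // ->.
rewrite /moebius (perm_all _ eq_primes) (perm_size eq_primes) /=.
rewrite lognM ?(prime_gt0 q_pr) // logn_prime // eqxx.
have -> : logn q e = 0%N by apply/eqP; rewrite -leqn0 leqNgt logn_gt0.
rewrite addn0 eqxx /= (@eq_in_all _ _ (fun p => logn p e == 1%N)); last first.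
  by move=> p /logn_e->.
by case: ifP; rewrite ?oppr0 // exprS mulN1r.
Qed.

(** Multiplying or dividing by a fixed prime factor of [N] is an involution of
    its squarefree divisors that changes the sign of the Moebius function. *)
Lemma sum_moebius_divisors (N : nat) : (0 < N)%N ->
  \sum_(e <- divisors N) moebius e = (N == 1)%:R.
Proof.
case: eqVneq => [-> _|N1 N0]; first by rewrite big_seq1.
have N_gt1 : (1 < N)%N by lia.
pose q := pdiv N; have q_pr : prime q by apply: pdiv_prime.
have qN : (q %| N)%N by apply: pdiv_dvd.
have q0 := prime_gt0 q_pr.
pose S := [seq e <- divisors N | moebius e != 0].
pose phi e := if (q %| e)%N then (e %/ q)%N else (q * e)%N.
have S_gt0 e : e \in S -> (0 < e)%N.
  rewrite mem_filter -dvdn_divisors // => /andP[_ eN].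
  exact: dvdn_gt0 eN.
have nq_div e : e \in S -> (q %| e)%N -> ~~ (q %| e %/ q)%N.
  move=> eS qe; apply/negP => qe'; have e0 := S_gt0 _ eS.
  have e'0 : (0 < e %/ q)%N by rewrite divn_gt0 // dvdn_leq.
  move: eS; rewrite mem_filter /moebius => /andP[+ _].
  case: allP => // /(_ q); rewrite mem_primes q_pr e0 qe => /(_ isT) + _.
  rewrite -(divnK qe) lognM // (@logn_prime q q) // eqxx addn1 eqSS -leqn0
    leqNgt.
  by rewrite logn_gt0 mem_primes q_pr e'0 qe'.
have mu_phi e : e \in S -> moebius (phi e) = - moebius e.
  move=> eS; rewrite /phi; case: ifPn => qe; last first.
    by rewrite moebius_prime_mul ?S_gt0.
  rewrite -{2}(divnK qe) mulnC moebius_prime_mul ?opprK ?nq_div //.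
  by rewrite divn_gt0 // dvdn_leq ?S_gt0.
have phiS e : e \in S -> phi e \in S.
  move=> eS; rewrite mem_filter mu_phi // oppr_eq0.
  move: (eS); rewrite mem_filter -!dvdn_divisors // => /andP[-> eN] /=.
  rewrite /phi; case: ifPn => qe; first exact: dvdn_trans (dvdn_div qe) eN.
  by rewrite Gauss_dvd ?qN // prime_coprime.
have phiK e : e \in S -> phi (phi e) = e.
  move=> eS; rewrite {2}/phi; case: ifPn => qe; rewrite /phi.
    by rewrite (negPf (nq_div _ eS qe)) mulnC divnK.
  by rewrite dvdn_mulr // mulKn.
have S_uniq : uniq S by rewrite filter_uniq ?divisors_uniq.
have sumS : \sum_(e <- divisors N) moebius e = \sum_(e <- S) moebius e.
  rewrite big_filter [LHS](bigID (fun e => moebius e != 0)) /=.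
  by rewrite [X in _ + X]big1 ?addr0 // => e; rewrite negbK => /eqP.
have perm_S : perm_eq S (map phi S).
  apply: uniq_perm => //.
    by rewrite map_inj_in_uniq // => e f eS fS /(congr1 phi); rewrite !phiK.
  move=> e; apply/idP/mapP => [eS|[f fS ->]]; last exact: phiS.
  by exists (phi e); rewrite ?phiS ?phiK.
have : \sum_(e <- S) moebius e = - \sum_(e <- S) moebius e.
  rewrite {1}(perm_big _ perm_S) big_map -sumrN big_seq [RHS]big_seq.
  by apply: eq_bigr => e /mu_phi.
by rewrite sumS; lia.
Qed.

(** Substituting the complementary divisor turns the multiples of [n0] dividing
    [n] into the divisors of [n %/ n0]. *)
Lemma sum_moebius_multiples (n n0 : nat) : (0 < n)%N ->
  \sum_(k <- divisors n) moebius (n %/ k) * (n0 %| k)%:R = (n0 == n)%:R.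
Proof.
move=> n_gt0; have divE k : (k \in divisors n) = (k %| n)%N.
  by rewrite -dvdn_divisors.
have [n0n|n0n] := boolP (n0 %| n)%N; last first.
  rewrite big_seq big1 => [|k]; last first.
    rewrite divE => kn; case: (boolP (n0 %| k)%N) => n0k; rewrite ?mulr0 //.
    by rewrite (dvdn_trans n0k kn) in n0n.
  by case: eqVneq n0n => // ->; rewrite dvdnn.
have n0_gt0 : (0 < n0)%N by apply: dvdn_gt0 n0n.
have perm_n : perm_eq (divisors n) [seq (n %/ k)%N | k <- divisors n].
  have divK k : (k %| n)%N -> (n %/ (n %/ k) = k)%N.
    by move=> kn; rewrite divnA // mulKn.
  apply: uniq_perm; rewrite ?divisors_uniq //.
    rewrite map_inj_in_uniq ?divisors_uniq // => k l; rewrite !divE => kn ln.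
    by move/(congr1 (divn n)); rewrite !divK.
  move=> k; rewrite divE; apply/idP/mapP => [kn|[l]].
    by exists (n %/ k)%N; rewrite ?divK // divE dvdn_div.
  by rewrite divE => ln ->; apply: dvdn_div.
have nn0 : (0 < n %/ n0)%N by rewrite divn_gt0 // dvdn_leq.
have perm_f : perm_eq [seq e <- divisors n | (e %| n %/ n0)%N] (divisors (n %/
  n0)).
  apply: uniq_perm; rewrite ?filter_uniq ?divisors_uniq // => e.
  rewrite mem_filter divE -dvdn_divisors //.
  by apply: andb_idr => /dvdn_trans; apply; apply: dvdn_div.
have -> : (n0 == n) = (n %/ n0 == 1)%N.
  by rewrite -[in LHS](divnK n0n) -[X in X == _]mul1n eqn_pmul2r // eq_sym.
rewrite -(sum_moebius_divisors nn0) -(perm_big _ perm_f) big_filter /=.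
rewrite (perm_big _ perm_n) big_map [RHS]big_mkcond.
rewrite big_seq [RHS]big_seq; apply: eq_bigr => e; rewrite divE => en.
have e_gt0 : (0 < e)%N by apply: dvdn_gt0 en.
rewrite divnA // mulKn //.
have -> : (n0 %| n %/ e)%N = (e %| n %/ n0)%N.
  rewrite -(@dvdn_pmul2r e) // divnK // -(@dvdn_pmul2r n0 e) // divnK //.
  by rewrite mulnC.
by case: ifP; rewrite ?mulr1 ?mulr0.
Qed.

(** The set described by [P] is stable under sums and differences.  The value
    [0] of [n0] stands for a set without positive elements. *)
Lemma multiples_of_least (P : pred nat) :
    (forall k l, (0 < k)%N -> (0 < l)%N -> P k -> P (k + l)%N = P l) ->
  exists n0, forall k, (0 < k)%N -> P k = (n0 %| k)%N.
Proof.
move=> Padd; pose Q k := (0 < k)%N && P k.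
case: (pselect (exists k, Q k)) => [exQ|noQ]; last first.
  exists 0%N => k k0; rewrite dvd0n gtn_eqF //; apply/negbTE/negP => Pk.
  by case: noQ; exists k; rewrite /Q k0.
case: (ex_minnP exQ) => n0 /andP[n0_gt0 Pn0] n0_min; exists n0 => k k0.
have Pmul q l : (0 < l)%N -> P (q * n0 + l)%N = P l.
  move=> l0; elim: q => [|q IH] //.
  by rewrite mulSn -addnA Padd ?addn_gt0 ?l0 ?orbT.
have [n0k|n0k] := boolP (n0 %| k)%N.
  have k_ge : (n0 <= k)%N by apply: dvdn_leq.
  by rewrite -(subnK k_ge) -(divnK (dvdn_sub n0k (dvdnn n0))) Pmul.
have r0 : (0 < k %% n0)%N by rewrite lt0n.
rewrite (divn_eq k n0) Pmul //; apply/negbTE/negP => Pr.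
by have := n0_min (k %% n0)%N; rewrite /Q r0 Pr leqNgt ltn_pmod // => /(_ isT).
Qed.

(** * Roots of the Misiurewicz polynomial *)

Lemma mup_simple (F : fieldType) (p : {poly F}) (x : F) : p != 0 ->
  (root p x -> p^`().[x] != 0) -> mup x p = root p x.
Proof.
move=> p0 simple; have [px|npx] := boolP (root p x); last by rewrite mupNroot.
apply/eqP; rewrite eqn_leq -XsubC_dvd // dvdp_XsubCl px andbT -ltnS mup_ltn //.
apply/negP => /dvdpP[q pE]; have /negP[] := simple px.
rewrite pE expr2 !derivM !hornerE subrr /=.
by rewrite !(mulr0, mul0r, addr0).
Qed.

(** Over an algebraically closed field divisibility is an inclusion of
    multisets of roots. *)
Lemma dvdp_mup (F : closedFieldType) (p q : {poly F}) : p != 0 -> q != 0 ->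
  (forall x, (mup x q <= mup x p)%N) -> q %| p.
Proof.
move=> p0 q0 le_qp.
have [rp pE] := closed_field_poly_normal p.
have [rq qE] := closed_field_poly_normal q.
have mupE (r : seq F) (l : F) x : l != 0 ->
    mup x (l *: \prod_(z <- r) ('X - z%:P)) = count_mem x r.
  by move=> l0; rewrite -mul_polyC mupMr ?mu_prod_XsubC // rootC.
have : forall x, (count_mem x rq <= count_mem x rp)%N.
  move=> x; have := le_qp x.
  by rewrite pE qE !mupE // lead_coef_eq0.
move/count_subseqP => [s /perm_to_subseq[s' perm_p] perm_q].
rewrite pE qE dvdpZl ?lead_coef_eq0 // dvdpZr ?lead_coef_eq0 //.
by rewrite (perm_big _ perm_q) (perm_big _ perm_p) big_cat dvdp_mulIl.
Qed.

(** The order [v] of a rational function at every point is computed from a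
    quotient that need not be reduced, so that no coprimality has to be
    maintained along products. *)
Definition has_order (F : fieldType) (phi : {fraction {poly F}})
    (v : F -> int) : Prop :=
  exists p q : {poly F}, [/\ p != 0, q != 0,
    phi = FracField.tofrac p / FracField.tofrac q &
    forall x, v x = (mup x p)%:Z - (mup x q)%:Z].

Section Order.
Variable F : fieldType.
Implicit Types (phi psi : {fraction {poly F}}) (v w : F -> int).

Lemma has_orderM phi psi v w : has_order phi v -> has_order psi w ->
  has_order (phi * psi) (fun x => v x + w x).
Proof.
move=> [p [q [p0 q0 -> vE]]] [p' [q' [p'0 q'0 -> wE]]].
exists (p * p'), (q * q'); split; rewrite ?mulf_neq0 //.
  by rewrite !tofracM invfM mulrACA.
by move=> x; rewrite !mupM // vE wE !PoszD; ring.
Qed.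

Lemma has_order1 : has_order (1 : {fraction {poly F}}) (fun=> 0).
Proof.
exists 1, 1; split; rewrite ?oner_neq0 //; last by move=> x; rewrite subrr.
by rewrite tofrac1 divr1.
Qed.

Lemma has_order_expn (p : {poly F}) k : p != 0 ->
  has_order (FracField.tofrac p ^+ k) (fun x => k%:Z * (mup x p)%:Z).
Proof.
move=> p0; exists (p ^+ k), 1; split; rewrite ?expf_neq0 ?oner_neq0 //.
  by rewrite tofracXn tofrac1 divr1.
move=> x; rewrite (@mupNroot _ _ 1) ?root1 // subr0.
elim: k => [|k IH]; first by rewrite mul0r expr0 mupNroot ?root1.
by rewrite exprS mupM ?expf_neq0 // PoszD -IH -[k.+1]add1n PoszD; ring.
Qed.

Lemma has_orderV phi v : has_order phi v -> has_order phi^-1 (fun x => - v x).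
Proof.
move=> [p [q [p0 q0 -> vE]]]; exists q, p; split => //.
  by rewrite invf_div.
by move=> x; rewrite vE opprB.
Qed.

Lemma has_order_ext phi v w : v =1 w -> has_order phi v -> has_order phi w.
Proof. by move=> vw [p [q [p0 q0 -> vE]]]; exists p, q; split=> // x;
  rewrite -vw. Qed.

Lemma has_order_expz (p : {poly F}) (z : int) : p != 0 ->
  has_order (FracField.tofrac p ^ z) (fun x => z * (mup x p)%:Z).
Proof.
move=> p0; case: z => k; first exact: has_order_expn.
apply: has_order_ext (has_orderV (has_order_expn k.+1 p0)) => x.
by rewrite NegzE mulNr.
Qed.

Lemma has_order_prod (I : eqType) (s : seq I) (f : I -> {poly F}) (e : I ->
  int) :
  (forall i, i \in s -> f i != 0) ->
  has_order (\prod_(i <- s) FracField.tofrac (f i) ^ e i)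
            (fun x => \sum_(i <- s) e i * (mup x (f i))%:Z).
Proof.
elim: s => [|i s IH] f0.
  by rewrite big_nil; apply: has_order_ext has_order1 => x; rewrite big_nil.
rewrite big_cons; apply: has_order_ext (has_orderM (has_order_expz _ _) (IH _)).
- by move=> x; rewrite big_cons.
- by apply: f0; rewrite mem_head.
- by move=> j js; apply: f0; rewrite in_cons js orbT.
Qed.

End Order.

(** A rational function without poles is a polynomial, and then its polynomial
    part has no other roots than its zeros. *)
Lemma root_poly_part (F : closedFieldType) (phi : {fraction {poly F}}) v x :
  has_order phi v -> (forall y, 0 <= v y) -> root (poly_part phi) x -> 0 < v x.
Proof.
move=> [p [q [p0 q0 phiE vE]]] v_ge0.
have /dvdpP[r pE] : q %| p.
  by apply: dvdp_mup => // y; have := v_ge0 y; rewrite vE subr_ge0 lez_nat.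
have r0 : r != 0 by apply: contra_neq p0 => r0; rewrite pE r0 mul0r.
have -> : poly_part phi = r.
  by rewrite phiE pE tofracM mulfK ?tofrac_eq0 // poly_part_tofrac.
by rewrite -dvdp_XsubCl XsubC_dvd // vE pE mupM // PoszD addrK ltz_nat.
Qed.

Section Misiurewicz.
Variables (F : numClosedFieldType) (d s n : nat) (zeta : F).
Hypotheses (d_prime : prime d) (zeta_root : zeta ^+ d = 1).
Hypotheses (zeta_neq1 : zeta != 1) (n_gt0 : (0 < n)%N).

(* The preperiod is [s.+2], so [B k] is [a_(m+k-1) - zeta a_(m-1)]. *)
Let B k : {poly F} := crit_val d 'X (s + k).+1 - zeta *: crit_val d 'X s.+1.

Let d_gt1 : (1 < d)%N. Proof. exact: prime_gt1. Qed.

Let BE k x : root (B k) x = (crit_val d x (s + k).+1 == zeta * crit_val d x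
  s.+1).
Proof. by rewrite /root hornerD hornerN hornerZ !crit_val_horner subr_eq0. Qed.

Let B_periodic k x : root (B k) x -> crit_val d x (s.+2 + k) = crit_val d x
  s.+2.
Proof.
rewrite BE => /eqP eq_B; rewrite addSn addSn.
rewrite [LHS]crit_valS [RHS]crit_valS eq_B.
by rewrite exprMn zeta_root mul1r.
Qed.

Let B_simple k x : (0 < k)%N -> root (B k) x -> (B k)^`().[x] != 0.
Proof.
move=> k0 Bx; apply: crit_val_twisted_simple => //.
  by apply: preperiodic_integral d_gt1 k0 (B_periodic Bx).
by move: Bx; rewrite BE => /eqP.
Qed.

Let B_neq0 k : (0 < k)%N -> B k != 0.
Proof.
move=> k0; apply/eqP => B0; have := @B_simple k 0 k0.
by rewrite B0 root0 derivC horner0 eqxx => /(_ isT).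
Qed.

Let a_simple k x : (0 < k)%N -> root (crit_val d ('X : {poly F}) k) x ->
  (crit_val d 'X k)^`().[x] != 0.
Proof.
move=> k0; rewrite /root crit_val_horner => /eqP kx.
apply: crit_val_derivative_neq0 => //.
exact: (@preperiodic_integral d F x 0 k).
Qed.

Let a_neq0 k : (0 < k)%N -> crit_val d ('X : {poly F}) k != 0.
Proof.
by case: k => // k _; rewrite monic_neq0 // (size_crit_val _ _ d_gt1).2.
Qed.

Let order x : int :=
  \sum_(k <- divisors n) moebius (n %/ k) * (mup x (B k))%:Z +
  (if (n %| s.+1)%N then
     \sum_(k <- divisors n) - moebius (n %/ k) * (mup x (crit_val d 'X k))%:Z
   else 0).

Let divisor_gt0 k : k \in divisors n -> (0 < k)%N.
Proof. by rewrite -dvdn_divisors // => /dvdn_gt0; apply. Qed.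

Let order_frac : has_order (misiurewicz_frac d s.+2 n zeta) order.
Proof.
rewrite /misiurewicz_frac [(s.+2 - 1)%N]subn1; apply: has_orderM.
  rewrite (@eq_big_seq _ _ _ _ _ _ (fun k => FracField.tofrac (B k) ^ moebius
    (n %/ k))).
    by apply: has_order_prod => k /divisor_gt0/B_neq0.
  move=> k _; rewrite addSn subn1 /= addSn.
  by rewrite !crit_orbitE ?(prime_gt0 d_prime).
case: ifP => _; last exact: has_order1.
rewrite (@eq_big_seq _ _ _ _ _ _
  (fun k => FracField.tofrac (crit_val d 'X k : {poly F}) ^ - moebius (n %/
    k))).
  by apply: has_order_prod => k /divisor_gt0/a_neq0.
by move=> k /divisor_gt0 k0; rewrite crit_orbitE ?(prime_gt0 d_prime).
Qed.

(** The set of [k] for which [x] is a root of the [k]-th factor consists of the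
    multiples of one number, so Moebius inversion leaves a contribution of [n]
    alone.  If the critical point is periodic with [a_(m-1)] vanishing, both
    products have the same roots and cancel each other. *)
Let order_bound x : 0 <= order x /\
  (0 < order x -> root (B n) x /\ crit_val d x s.+1 != 0).
Proof.
have [n0 n0E] : exists n0, forall k, (0 < k)%N -> root (B k) x = (n0 %| k)%N.
  apply: multiples_of_least => k l k0 l0 /B_periodic/(@crit_val_shift _ _ _ _ _
    l.-1) eq_k.
  rewrite !BE; congr (_ == _); move: eq_k.
  have -> : (s.+2 + k + l.-1 = (s + (k + l)).+1)%N by lia.
  by have -> : (s.+2 + l.-1 = (s + l).+1)%N by lia.
have [n1 n1E] : exists n1, forall k, (0 < k)%N -> (crit_val d x k == 0) = (n1
  %| k)%N.
  by apply: multiples_of_least => k l _ _ /eqP/crit_valD0->.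
have sumB : \sum_(k <- divisors n) moebius (n %/ k) * (mup x (B k))%:Z = (n0 ==
  n)%:R.
  rewrite -sum_moebius_multiples //; apply: eq_big_seq => k /divisor_gt0 k0.
  rewrite (mup_simple (B_neq0 k0)) => [|Bx]; last exact: B_simple.
  by rewrite n0E //; case: (_ %| _)%N.
have suma : \sum_(k <- divisors n) - moebius (n %/ k) * (mup x (crit_val d 'X
  k))%:Z
    = - (n1 == n)%:R.
  rewrite -sum_moebius_multiples // -sumrN;
    apply: eq_big_seq => k /divisor_gt0 k0.
  rewrite mulNr (mup_simple (a_neq0 k0)) => [|ax]; last exact: a_simple.
  by rewrite /root crit_val_horner n1E //; case: (_ %| _)%N.
rewrite /order sumB suma; have [as0|as0] /= := eqVneq (crit_val d x s.+1) 0.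
  have n01 k : (0 < k)%N -> (n0 %| k)%N = (n1 %| k)%N.
    by move=> k0; rewrite -n0E // -n1E // BE as0 mulr0 -addSn crit_valD0.
  have eqn_of (a b : nat) : (forall k, (0 < k)%N -> (a %| k) = (b %| k))%N ->
      a == n -> b == n.
    move=> ab /eqP an; have bn : (b %| n)%N by rewrite -ab // an.
    by rewrite eqn_dvd bn -an ab ?(dvdn_gt0 n_gt0 bn) /=.
  have -> : (n0 == n) = (n1 == n).
    by apply/idP/idP; apply: eqn_of => k /n01.
  case: eqVneq => [n1n|_]; last by case: ifP; rewrite ?oppr0 addr0.
  by rewrite -n1n -n1E ?as0 ?eqxx ?subrr.
have -> : (if (n %| s.+1)%N then - (n1 == n)%:R else 0) = 0 :> int.
  case: ifP => // ns; have [n1n|_] := eqVneq n1 n; last by rewrite oppr0.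
  by rewrite n1E // n1n ns in as0.
by rewrite addr0; case: eqVneq => [n0n|]; rewrite // n0E // n0n.
Qed.

Lemma misiurewicz_poly_root x : root (misiurewicz_poly d s.+2 n zeta) x ->
  crit_val d x (s + n).+1 = zeta * crit_val d x s.+1 /\ crit_val d x s.+1 != 0.
Proof.
move/(root_poly_part order_frac (fun y => (order_bound y).1)).
by case/(order_bound x).2; rewrite BE => /eqP.
Qed.

End Misiurewicz.

(** * The critical orbit in a local ring of residue characteristic [d] *)

Section LocalRing.
Variables (K : fieldType) (A : subringClosed K) (M : zmodClosed K).
Hypotheses (M_sub : {subset M <= A}) (M1 : 1 \notin M).
Hypothesis M_ideal : forall a x, a \in A -> x \in M -> a * x \in M.
Hypothesis A_inv : forall x, x \in A -> x \notin M -> x^-1 \in A.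

Lemma maximal_exp x k : x \in A -> x ^+ k \in M -> x \in M.
Proof.
move=> xA xkM; apply: contraT => xNM; have x0 : x != 0.
  by apply: contraNneq xNM => ->; rewrite rpred0.
have: x^-1 ^+ k * x ^+ k \in M by rewrite M_ideal ?rpredX ?A_inv.
by rewrite -exprMn mulVf // expr1n (negPf M1).
Qed.

Lemma unit_1D y : y \in M -> 1 + y \in A /\ 1 + y \notin M.
Proof.
move=> yM; split; first by rewrite rpredD ?rpred1 ?M_sub.
by apply: contra M1 => y1M; rewrite -(addrK y 1) rpredB.
Qed.

Lemma unit_1D_neq0 y : y \in M -> 1 + y != 0.
Proof. by move=> /unit_1D[_]; apply: contraNneq => ->; rewrite rpred0. Qed.

Lemma multiple_of_max t x : t \in M -> t != 0 -> x \in multiple_of A t -> x \in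
  M.
Proof. by move=> tM t0 /(multipleP t0)[y yA ->]; rewrite mulrC M_ideal. Qed.

Variables (d : nat) (c : K).
Hypotheses (d_prime : prime d) (dM : d%:R \in M) (cA : c \in A).

Let a i := crit_val d c i.

Let aA i : a i \in A. Proof. exact: crit_val_mem. Qed.

Let d_gt0 : (0 < d)%N. Proof. exact: prime_gt0. Qed.

Let d1_gt0 : (0 < d.-1)%N. Proof. by have := prime_gt1 d_prime; lia. Qed.

Let exprB_prime x y : x \in A -> y \in A ->
  exists2 z, z \in A & x ^+ d - y ^+ d = (x - y) ^+ d + d%:R * ((x - y) * z).
Proof.
move=> xA yA; have xyA : x - y \in A by rewrite rpredB.
have [w wA] := exprD_prime d_prime yA xyA.
rewrite [y + _]addrC subrK => ->.
exists (y * (y ^+ d.-2 + (x - y) * w)); last by ring.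
by rewrite rpredM // rpredD ?rpredX ?rpredM.
Qed.

(** The derivative of [x ^ d] vanishes in the residue field. *)
Lemma contracting x y : x \in A -> y \in A -> x - y \in M ->
  exists2 z, z \in M & x ^+ d - y ^+ d = (x - y) * z.
Proof.
move=> xA yA xyM; have [z zA ->] := exprB_prime xA yA.
exists ((x - y) ^+ d.-1 + z * d%:R).
  rewrite rpredD ?(M_ideal zA dM) // -(prednK d1_gt0).
  by rewrite exprSr M_ideal ?rpredX ?M_sub.
by rewrite mulrDr -exprS prednK  //; ring.
Qed.

(** Iterating the contraction.  The cofactor is a non-unit as soon as one step
    is made. *)
Lemma crit_val_near k i j : a k \in M -> a (i + k) - a i \in M /\
  exists2 z, z \in (if j is 0 then A : {pred K} else M : {pred K}) &
    a (i + j + k) - a (i + j) = (a (i + k) - a i) * z.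
Proof.
move=> akM; have near i' : a (i' + k) - a i' \in M.
  elim: i' => [|i' IH]; first by rewrite subr0.
  have [z zM] := contracting (aA _) (aA _) IH.
  rewrite addSn /a !crit_valS opprD addrACA subrr addr0 => ->.
  by rewrite mulrC M_ideal ?M_sub.
split=> //; elim: j => [|j [z zM IH]].
  by exists 1; rewrite ?rpred1 // addn0 mulr1.
have [y yM] := contracting (aA (i + j + k)%N) (aA _) (near _).
rewrite addnS addSn /a !crit_valS opprD addrACA subrr addr0 => ->.
exists (z * y); last by rewrite mulrA IH.
by apply: M_ideal yM; case: (j) zM => // j' /M_sub.
Qed.

(** The [d]-th power map is injective on the residue field. *)
Lemma crit_val_far k i : a (i + k) - a i \in M -> a k \in M.
Proof.
elim: i => [|i IH]; first by rewrite subr0.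
have [z zA] := exprB_prime (aA (i + k)) (aA i).
rewrite addSn /a !crit_valS opprD addrACA subrr addr0 => -> eM.
apply: IH; apply: (@maximal_exp _ d); first by rewrite rpredB.
have dzM : (a (i + k) - a i) * z * d%:R \in M.
  by rewrite M_ideal // rpredM // rpredB.
by rewrite -(addrK ((a (i + k) - a i) * z * d%:R) (_ ^+ d)) rpredB // mulrC.
Qed.

Variables (s n : nat).
Hypotheses (n_gt0 : (0 < n)%N) (eq_pow : a (s + n).+1 ^+ d = a s.+1 ^+ d).
Hypothesis neq_val : a (s + n).+1 != a s.+1.

Let periodic : a (s.+2 + n) = a s.+2.
Proof. by rewrite addSn addSn /a [LHS]crit_valS [RHS]crit_valS -/(a _) eq_pow.
  Qed.

Let period_max : a n \in M.
Proof.
apply: (@crit_val_far _ s.+2); rewrite periodic subrr; exact: rpred0.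
Qed.

Lemma residual_period : exists2 r, (0 < r)%N &
  forall k, (0 < k)%N -> (a k \in M) = (r %| k)%N.
Proof.
have [r rE] : exists r, forall k, (0 < k)%N -> (a k \in M) = (r %| k)%N.
  apply: multiples_of_least => k l _ _ akM.
  have [+ _] := crit_val_near l 0 akM; rewrite addnC => klM.
  by rewrite -[in LHS](subrK (a l) (a (k + l))) rpredDl.
by exists r => //; apply: dvdn_gt0 n_gt0 _; rewrite -rE.
Qed.

(** Points of a cycle in the same residue class are equal, because the map
    contracts the distance of such points.  Hence the period of the critical
    orbit is already its period in the residue field. *)
Lemma residual_period_exact r : (0 < r)%N -> (r %| n)%N -> a r \in M ->
  a (s + r).+1 = a (s + n).+1.
Proof.
move=> r_gt0 rn arM; have [_ [z zM]] := crit_val_near s.+2 n arM.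
have {}zM : z \in M by case: (n) n_gt0 zM.
have -> : a (s.+2 + n + r) = a (s.+2 + r) by apply: crit_val_shift periodic.
rewrite periodic => /eqP.
rewrite -subr_eq0 -[X in X - _]mulr1 -mulrBr mulf_eq0 subr_eq0.
have -> : (1 - z == 0) = false.
  by apply/negbTE; apply: unit_1D_neq0; rewrite rpredN.
rewrite orbF => /eqP per_r.
have mul_r q : a (s + r + q * r).+1 = a (s + r).+1.
  elim: q => [|q IH]; first by rewrite addn0.
  rewrite -[RHS]IH mulSn.
  have := crit_val_shift (r.-1 + q * r) per_r.
  have -> : (s.+2 + r + (r.-1 + q * r) = (s + r + (r + q * r)).+1)%N by lia.
  by have -> : (s.+2 + (r.-1 + q * r) = (s + r + q * r).+1)%N by lia.
rewrite -(divnK rn) -(mul_r (n %/ r).-1); congr (a _.+1).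
have : (0 < n %/ r)%N by rewrite divn_gt0 // dvdn_leq.
by case: (n %/ r)%N => // q _; rewrite mulSn addnA.
Qed.

(** With [r] the residual period and [t = a_(s+r+1) / a_(s+1) - 1], one has
    [(1 + t) ^ d = 1], so that [d] is [- t ^ (d - 1)] up to a unit.  The
    numerator of [t] is a multiple of [a_r ^ d] by contraction.  The denominator
    is either a unit or [a_r] up to a unit, so [a_r] divides [t], hence [d].
    Conversely the differences [a_(i+r) - a_i] are the iterated [d]-th powers of
    [a_r] modulo [d], and the last one is a multiple of [t], so a power of [a_r]
    is a multiple of [d]. *)
Lemma local_uniformizer : exists r, [/\ (0 < r)%N, a r \in M & a r != 0] /\
  [/\ d%:R != 0 :> K, d%:R \in multiple_of A (a r),
  (exists k, a r ^+ k \in multiple_of A d%:R) &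
  forall j, exists2 z, z \in M & a (r * j.+1) = a r * (1 + z)].
Proof.
have [r r_gt0 rE] := residual_period; exists r.
have arM : a r \in M by rewrite rE.
have rn : (r %| n)%N by rewrite -rE.
have [eq_powr neq_valr] :
    a (s.+1 + r) ^+ d = a s.+1 ^+ d /\ a (s.+1 + r) != a s.+1.
  by rewrite addSn residual_period_exact.
pose D i := a (i + r) - a i.
have DA i : D i \in A by rewrite rpredB.
have D1 : D 1%N = a r ^+ d.
  by rewrite /D add1n /a !crit_valS opprD addrACA subrr addr0 expr0n gtn_eqF
     ?subr0.
have D_mul i : exists2 z, z \in A & D i.+1 = a r ^+ d * z.
  have [_ [z zM DE]] := crit_val_near 1 i arM; exists z; last by rewrite -D1.
  by case: i zM {DE} => // i /M_sub.
have ar0 : a r != 0.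
  apply: contraNneq neq_valr => ar0; have [z _] := D_mul s.
  by rewrite ar0 expr0n gtn_eqF // mul0r => /eqP; rewrite subr_eq0.
have expd : a r ^+ d = a r * a r ^+ d.-1 by rewrite -exprS prednK.
have expd1M : a r ^+ d.-1 \in M.
  by rewrite -(prednK d1_gt0) exprSr M_ideal ?rpredX.
have mul_r j : exists2 z, z \in M & a (r * j.+1) = a r * (1 + z).
  elim: j => [|j [z zM IH]].
    by exists 0; rewrite ?rpred0 // addr0 mulr1 muln1.
  have rj : (0 < r * j.+1)%N by rewrite muln_gt0 r_gt0.
  have [y yA] := D_mul (r * j.+1).-1; rewrite prednK //.
  rewrite /D -mulnSr => /eqP; rewrite subr_eq => /eqP->.
  exists (y * a r ^+ d.-1 + z); last by rewrite IH expd; ring.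
  by rewrite rpredD // M_ideal.
have as0 : a s.+1 != 0.
  apply: contraNneq neq_valr => as0; move/eqP: eq_powr.
  by rewrite as0 expr0n gtn_eqF // expf_eq0 d_gt0.
pose t := D s.+1 / a s.+1.
have t0 : t != 0 by rewrite mulf_neq0 ?invr_eq0 // subr_eq0.
have t_ar : t \in multiple_of A (a r).
  have [y yA DE] := D_mul s.
  have [asM|asM] := boolP (a s.+1 \in M); last first.
    rewrite /t DE expd -!mulrA multiple_mulr ?multiple_refl //.
    by rewrite (rpredM (M_sub expd1M)) // rpredM // A_inv.
  have /dvdnP[[|j] sE] : (r %| s.+1)%N by rewrite -rE.
    by rewrite mul0n in sE.
  have [z zM aE] := mul_r j; have [zA zNM] := unit_1D zM.
  rewrite /t DE sE mulnC aE expd invfM.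
  have -> : a r * a r ^+ d.-1 * y * ((a r)^-1 * (1 + z)^-1) =
      a r ^+ d.-1 * (y * (1 + z)^-1).
    by field; rewrite ar0 unit_1D_neq0.
  rewrite -(prednK d1_gt0) exprS -mulrA multiple_mulr ?multiple_refl //.
  by rewrite rpredM ?rpredX // rpredM // A_inv.
have tM : t \in M by apply: multiple_of_max t_ar.
have [w wA w_eq] : exists2 w, w \in A & t ^+ d.-1 + d%:R * (1 + t * w) = 0.
  apply: root_unity_sub1; rewrite ?M_sub //.
  have -> : 1 + t = a (s.+1 + r) / a s.+1.
    by rewrite /t /D mulrBl divff // addrC subrK.
  by rewrite expr_div_n eq_powr divff ?expf_neq0.
have [uA uNM] : 1 + t * w \in A /\ 1 + t * w \notin M.
  by apply: unit_1D; rewrite mulrC M_ideal.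
have d0 : d%:R != 0 :> K.
  apply: contraNneq t0 => d0; move: w_eq; rewrite d0 mul0r addr0 => /eqP.
  by rewrite expf_eq0 => /andP[].
have u0 : 1 + t * w != 0 by apply: unit_1D_neq0; rewrite mulrC M_ideal.
split=> //; split=> //.
- have -> : d%:R = - (t ^+ d.-1 * (1 + t * w)^-1).
    apply: (mulIf u0); rewrite mulNr mulfVK //.
    by apply/eqP; rewrite -addr_eq0 addrC w_eq.
  rewrite rpredN -(prednK d1_gt0) exprS -mulrA multiple_mulr //.
  by rewrite rpredM ?A_inv // rpredX // M_sub.
- have mod_d i : (exists k, D i.+1 ^+ k \in multiple_of A d%:R) ->
      exists k, D i ^+ k \in multiple_of A d%:R.
    move=> [k DkM]; exists (d * k)%N.
    have [z zA] := exprB_prime (aA (i + r)) (aA i).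
    have -> : a (i + r) ^+ d - a i ^+ d = D i.+1.
      by rewrite /D addSn /a !crit_valS; ring.
    rewrite -/(D i) => DE; rewrite exprM.
    rewrite -(subrK (D i.+1 ^+ k) (_ ^+ k)) rpredD // subrXX.
    have -> : D i ^+ d - D i.+1 = d%:R * - (D i * z) by rewrite DE; ring.
    rewrite -mulrA multiple_mulr ?multiple_refl // rpredM ?rpredN ?rpredM //.
    by apply: rpred_sum => j _; rewrite rpredM ?rpredX.
  have : exists k, D s.+1 ^+ k \in multiple_of A d%:R.
    exists d.-1; have -> : D s.+1 = t * a s.+1 by rewrite divfK.
    rewrite exprMn multiple_mulr ?rpredX //.
    have -> : t ^+ d.-1 = d%:R * - (1 + t * w).
      by apply/eqP; rewrite mulrN -addr_eq0 w_eq.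
    by rewrite multiple_mulr ?multiple_refl ?rpredN.
  elim: s.+1 => [|i IH /mod_d/IH //].
  by rewrite /D subr0.
Qed.

End LocalRing.

(** * Eisenstein's criterion for a valuation *)

Section Eisenstein.
Variables (K : fieldType) (v : K -> int).
Hypothesis vM : forall x y, x != 0 -> y != 0 -> v (x * y) = v x + v y.
Hypothesis vD : forall x y, x != 0 -> y != 0 -> x + y != 0 ->
  v x <= v (x + y) \/ v y <= v (x + y).

Let v1 : v 1 = 0.
Proof.
have := vM (oner_neq0 K) (oner_neq0 K); rewrite mulr1 => e.
by apply: (addrI (v 1)); rewrite addr0 -e.
Qed.

Let vN x : v (- x) = v x.
Proof.
have [->|x0] := eqVneq x 0; first by rewrite oppr0.
have N1 : (-1 : K) != 0 by rewrite oppr_eq0 oner_neq0.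
have := vM N1 N1; rewrite mulrNN mulr1 v1 => vN1.
suff vN1_0 : v (-1) = 0 by rewrite -mulN1r vM // vN1_0 add0r.
by move: (v (-1)) vN1 => z; lia.
Qed.

Let v_dominant x y : x != 0 -> (y == 0) || (v x < v y) ->
  x + y != 0 /\ v (x + y) = v x.
Proof.
move=> x0; have [->|y0] /= := eqVneq y 0; first by rewrite addr0.
move=> lt_xy; have xy0 : x + y != 0.
  by apply: contraTneq lt_xy => /eqP; rewrite addr_eq0 => /eqP ->;
    rewrite vN ltxx.
split=> //; have := vD x0 y0 xy0.
have := @vD (x + y) (- y); rewrite oppr_eq0 addrK vN => /(_ xy0 y0 x0); lia.
Qed.

Variable D : nat.

(* The zero coefficient has infinite weight. *)
Let above (W : int) (l : nat) : {pred K} :=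
  fun x => (x == 0) || (W < v x * D%:Z + l%:Z).

Let aboveE W l x : (x \in above W l) = (x == 0) || (W < v x * D%:Z + l%:Z).
Proof. by []. Qed.

Let above_sum (W : int) (l : nat) (I : finType) (P : pred I) (f : I -> K) :
  (forall i, P i -> f i \in above W l) -> \sum_(i | P i) f i \in above W l.
Proof.
move=> f_above; elim/big_rec: _ => [|i x /f_above];
  first by rewrite aboveE eqxx.
rewrite !aboveE; have [->|fi0] /= := eqVneq (f i) 0; first by rewrite add0r.
have [->|x0] /= := eqVneq x 0; first by rewrite addr0 => ->; rewrite orbT.
have [->|fx0] //= := eqVneq (f i + x) 0.
have weight_mono (a b : int) : a <= b -> a * D%:Z <= b * D%:Z.
  by move=> ab; rewrite ler_wpM2r.
by move=> Wf Wx; case: (vD fi0 x0 fx0) => /weight_mono le_w;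
  [apply: lt_le_trans Wf _|apply: lt_le_trans Wx _]; rewrite lerD2r.
Qed.

Let weight_inj (a b : int) (i j : nat) : (i < D)%N -> (j < D)%N ->
  a * D%:Z + i%:Z = b * D%:Z + j%:Z -> i = j.
Proof.
move=> iD jD ab; have [lt_ab|lt_ba|eq_ab] := ltgtP a b; last by move: ab;
  rewrite eq_ab; lia.
  have : (a + 1) * D%:Z <= b * D%:Z by rewrite ler_wpM2r // ?lez_nat //; lia.
  by rewrite mulrDl mul1r; lia.
have : (b + 1) * D%:Z <= a * D%:Z by rewrite ler_wpM2r // ?lez_nat //; lia.
by rewrite mulrDl mul1r; lia.
Qed.

(** The weights of the coefficients of a polynomial of degree less than [D] are
    distinct, being distinct modulo [D]. *)
Let least_weight (g : {poly K}) : g != 0 -> (size g <= D)%N ->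
  exists i, g`_i != 0 /\
    forall j, j != i -> g`_j \in above (v g`_i * D%:Z + i%:Z) j.
Proof.
move=> g0 sz_g; pose w (i : 'I_(size g)) : int := v g`_i * D%:Z + (i : nat)%:Z.
have sz0 : (0 < size g)%N by rewrite size_poly_gt0.
have last_lt : ((size g).-1 < size g)%N by rewrite prednK.
have last_neq0 : g`_(Ordinal last_lt) != 0 by rewrite /= -lead_coefE
  lead_coef_eq0.
case: (@arg_minP _ _ _ (Ordinal last_lt) (fun i => g`_i != 0) w) => //.
move=> i gi0 i_min; exists i; split=> // j ji; rewrite aboveE.
have [//|gj0] /= := eqVneq g`_j 0.
have lt_j : (j < size g)%N.
  by rewrite ltnNge; apply: contra gj0 => /(nth_default 0) ->.
have := i_min (Ordinal lt_j) gj0; rewrite /w /= => le_ij.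
rewrite lt_neqAle le_ij andbT; apply: contra ji => /eqP/weight_inj -> //.
  exact: leq_trans (ltn_ord i) sz_g.
exact: leq_trans lt_j sz_g.
Qed.

(** The weight [D * v + degree] is attained twice by an Eisenstein polynomial
    of degree [D], in degrees [0] and [D], but exactly once by each factor of
    smaller degree, hence exactly once by their product. *)
Theorem eisenstein_irreducible (f : {poly K}) : (0 < D)%N ->
  size f = D.+1 -> f \is monic -> f`_0 != 0 -> v f`_0 = 1 ->
  (forall k, (0 < k < D)%N -> f`_k != 0 -> 1 <= v f`_k) ->
  irreducible_poly f.
Proof.
move=> D0 sz_f f_monic f0 vf0 vfk.
split=> [|q sz_q q_f]; first by rewrite sz_f.
have f_neq0 : f != 0 by apply: monic_neq0.
have le_q := dvdp_leq f_neq0 q_f.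
rewrite -(dvdp_size_eqp q_f); apply: contraT => neq_sz.
have /dvdpP[r fE] := q_f.
have [r0 q0] : r != 0 /\ q != 0 by apply/andP; rewrite -negb_or -mulf_eq0 -fE.
have sz_rq := size_mul r0 q0; rewrite -fE sz_f in sz_rq.
have q_gt0 : (0 < size q)%N by rewrite size_poly_gt0.
have r_gt0 : (0 < size r)%N by rewrite size_poly_gt0.
have qD : (size q <= D)%N by rewrite -ltnS ltn_neqAle -sz_f neq_sz.
have rD : (size r <= D)%N.
  move: sz_rq sz_q q_gt0; clear; move: (size q) (size r) => b a; lia.
have [i [ri0 i_min]] := least_weight r0 rD.
have [j [qj0 j_min]] := least_weight q0 qD.
pose W := v r`_i * D%:Z + i%:Z + (v q`_j * D%:Z + j%:Z).
have term_above l (a : 'I_l.+1) : (a != i :> nat) || (l - a != j)%N ->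
    r`_a * q`_(l - a) \in above W l.
  move=> neq_ij; rewrite aboveE mulf_eq0.
  have [//|ra0] /= := eqVneq r`_a 0; have [//|qb0] /= := eqVneq q`_(l - a) 0.
  have := i_min a; have := j_min (l - a)%N;
    rewrite !aboveE (negPf ra0) (negPf qb0) /=.
  have lE : l%:Z = (a : nat)%:Z + (l - a)%N%:Z by rewrite -PoszD subnKC //
    -ltnS.
  rewrite vM // lE mulrDl addrACA /W.
  have [aE|_] := eqVneq (a : nat) i; last first.
    have [->|_] := eqVneq (l - a)%N j; first by move=> _ /(_ isT);
      rewrite ltrD2r.
    by move=> /(_ isT) + /(_ isT) => *; apply: ltrD.
  move: neq_ij; rewrite aE eqxx /= => -> /(_ isT) + _.
  by rewrite ltrD2l.
have other l : l != (i + j)%N -> f`_l \in above W l.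
  move=> l_neq; rewrite fE coefM; apply: above_sum => a _; apply: term_above.
  rewrite -negb_and; apply: contra l_neq => /andP[/eqP<- /eqP<-].
  by rewrite subnKC // -ltnS.
have [fl0 vfl] : f`_(i + j) != 0 /\ v f`_(i + j) = v r`_i + v q`_j.
  have lt_i : (i < (i + j).+1)%N by rewrite ltnS leq_addr.
  rewrite fE coefM (bigD1 (Ordinal lt_i)) //= addKn -vM //.
  apply: v_dominant; first by rewrite mulf_neq0.
  have : \sum_(a < (i + j).+1 | a != Ordinal lt_i) r`_a * q`_(i + j - a) \in
    above W (i + j).
    by apply: above_sum => a a_neq; apply: term_above; rewrite a_neq.
  rewrite aboveE; case: eqP => //= _.
  have -> : W = v (r`_i * q`_j) * D%:Z + (i + j)%N%:Z by rewrite vM // PoszD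
    /W; ring.
  rewrite ltrD2r => lt_v; rewrite ltNge; apply/negP => le_v; move: lt_v.
  by rewrite ltNge ler_wpM2r.
have f_D : f`_D = 1 by rewrite -(monicP f_monic) lead_coefE sz_f.
have := other 0%N; have := other D;
  rewrite !aboveE f_D oner_eq0 (negPf f0) vf0 v1 /=.
have le_l : (i + j <= D)%N.
  by rewrite -ltnS -sz_f ltnNge; apply: contra fl0 => /(nth_default 0) ->.
have WE : W = v f`_(i + j) * D%:Z + (i + j)%:Z by rewrite vfl /W PoszD; ring.
rewrite mul0r mul1r add0r addr0.
have [l0|l0] := eqVneq 0%N (i + j)%N; last first.
  have [lD|lD] := eqVneq D (i + j)%N; last first.
    move=> _ /(_ isT) W_lt; have l_mid : (0 < i + j < D)%N by lia.
    have := vfk _ l_mid fl0; rewrite WE in W_lt.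
    have : D%:Z <= v f`_(i + j) * D%:Z.
      by rewrite -[leLHS]mul1r ler_wpM2r // vfk.
    lia.
  move=> _ /(_ isT); rewrite WE -lD f_D v1 mul0r add0r ltxx //.
have /negPf -> : D != (i + j)%N by rewrite -l0 -lt0n.
by move=> /(_ isT) W_lt; rewrite WE -l0 vf0 mul1r addr0 ltxx in W_lt.
Qed.

End Eisenstein.

(** * Prime ideals of [Z[X]] containing a polynomial separable modulo [d] *)

Section ReductionMod.
Variables (d : nat).
Hypothesis d_prime : prime d.

Definition red_poly (P : {poly int}) : {poly 'F_d} := map_poly intr P.

Lemma red_polyB P Q : red_poly (P - Q) = red_poly P - red_poly Q.
Proof. by rewrite /red_poly rmorphB. Qed.

Lemma red_polyM P Q : red_poly (P * Q) = red_poly P * red_poly Q.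
Proof. by rewrite /red_poly rmorphM. Qed.

Lemma red_poly_surj (g : {poly 'F_d}) : exists P, red_poly P = g.
Proof.
pose lift (x : 'F_d) : int := (x : nat)%:Z.
have lift0 : lift 0 = 0 by [].
exists (map_poly lift g); apply/polyP => i.
by rewrite !(coef_map_id0, coef_map) //= /lift -pmulrn natr_Zp.
Qed.

Lemma red_poly_eq0 P : red_poly P = 0 -> exists Q, P = d%:R * Q.
Proof.
move=> P0; have div0 : (0 %/ d)%Z = 0 by rewrite div0z.
exists (map_poly (fun z => (z %/ d)%Z) P); apply/polyP => i.
rewrite mulr_natl coefMn coef_map_id0 // -mulr_natr.
have /eqP : (red_poly P)`_i = 0 by rewrite P0 coef0.
rewrite coef_map /= -(dvdz_pcharf (pchar_Fp d_prime)) => /divzK {1}<-.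
by rewrite mulrC natz mulrC.
Qed.

Variables (O : comNzRingType) (ev : {rmorphism {poly int} -> O}).
Variable p : prime_idealr O.
Hypothesis dp : d%:R \in p.

Lemma red_poly_mem P Q : red_poly P = red_poly Q -> (ev P \in p) = (ev Q \in p).
Proof.
move=> PQ; have [R eqR] : exists R, P - Q = d%:R * R.
  by apply: red_poly_eq0; rewrite red_polyB PQ subrr.
rewrite -[P](subrK Q) eqR rmorphD rmorphM rmorph_nat mulrC rpredDl //.
exact: idealMr.
Qed.

(* The image of the prime ideal in ['F_d[X]]. *)
Let J (f : {poly 'F_d}) : Prop := exists2 P, red_poly P = f & ev P \in p.

Let J_red P : J (red_poly P) <-> ev P \in p.
Proof. by split=> [[Q /red_poly_mem <-]|pP] //; exists P. Qed.

Let J_dvd f g : f %| g -> J f -> J g.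
Proof.
move=> /dvdpP[q ->] [P <- pP]; have [Q <-] := red_poly_surj q.
by rewrite -red_polyM J_red rmorphM idealMr.
Qed.

Let J_add f g : J f -> J g -> J (f + g).
Proof.
move=> [P <- pP] [Q <- pQ]; exists (P + Q); first by rewrite /red_poly rmorphD.
by rewrite rmorphD rpredD.
Qed.

Let J_gcd f g : J f -> J g -> J (gcdp f g).
Proof.
move=> Jf Jg; have [[u v] /= /andP[uv_gcd _]] := Bezoutp f g.
apply: J_dvd uv_gcd _.
by apply: J_add; [apply: J_dvd Jf | apply: J_dvd Jg]; rewrite dvdp_mulIr.
Qed.

Let J_coprime f g : coprimep f g -> J f -> J g -> False.
Proof.
move=> /Bezout_coprimepP[[u v] /= eq1] Jf Jg.
have : J 1.
  apply: (@J_dvd (u * f + v * g)); first by case/andP: eq1.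
  by apply: J_add; [apply: J_dvd Jf | apply: J_dvd Jg]; rewrite dvdp_mulIr.
move=> [P P1]; rewrite (red_poly_mem (Q := 1)) ?rmorph1 ?idealr1 //.
by rewrite P1 /red_poly rmorph1.
Qed.

Variable g : {poly int}.
Hypotheses (g_sep : separable_poly (red_poly g)) (gp : ev g \in p).

(** The common factor of [g] with [P] modulo [d] is coprime to its cofactor in
    [g], so the ideal contains exactly one of the two. *)
Let split_gcd P : exists2 b,
  red_poly g = b * gcdp (red_poly g) (red_poly P) &
  coprimep b (gcdp (red_poly g) (red_poly P)).
Proof.
have /dvdpP[b gE] := dvdp_gcdl (red_poly g) (red_poly P).
exists b => //; move: g_sep; rewrite {1}gE separable_mul => /and3P[] //.
Qed.

(** Modulo [d], the part of [g] prime to [P] lies outside the ideal, and its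
    product with [P] is a multiple of [g]. *)
Lemma local_generator P : ev P \in p -> exists S Q R : {poly int},
  ev S \notin p /\ S * P = g * Q + d%:R * R.
Proof.
move=> pP; have [b gE cop_b] := split_gcd P.
have /dvdpP[q PE] := dvdp_gcdr (red_poly g) (red_poly P).
have [S SE] := red_poly_surj b; have [Q QE] := red_poly_surj q.
have [R RE] : exists R, S * P - g * Q = d%:R * R.
  by apply: red_poly_eq0; rewrite red_polyB !red_polyM SE QE {1}PE {2}gE; ring.
exists S, Q, R; split; last by rewrite -RE addrC subrK.
apply/negP => /J_red; rewrite SE => Jb.
exact: J_coprime cop_b Jb (J_gcd ((J_red g).2 gp) ((J_red P).2 pP)).
Qed.

(** The cofactor in [g] of the common factor with [P] now lies in the ideal, and
    it is coprime to [P] modulo [d]. *)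
Lemma inverse_mod P : ev P \notin p -> exists Q, ev (P * Q - 1) \in p.
Proof.
move=> pP; have [b gE cop_b] := split_gcd P.
have [B BE] := red_poly_surj b.
have [H HE] := red_poly_surj (gcdp (red_poly g) (red_poly P)).
have Jb : J b.
  have : ev (B * H) \in p.
    by rewrite (red_poly_mem (Q := g)) // red_polyM BE HE -gE.
  rewrite rmorphM prime_idealrM => /orP[|/J_red]; first by exists B.
  rewrite HE => /(J_dvd (dvdp_gcdr _ _))/J_red pP'.
  by rewrite pP' in pP.
have /Bezout_coprimepP[[u v] /=] : coprimep b (red_poly P).
  apply/coprimepP => e eb eP; move/coprimepP: cop_b; apply => //.
  by rewrite dvdp_gcd eP gE dvdp_mulr.
rewrite -size_poly_eq1 => /size_poly1P[k k0 uvE].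
have [Q QE] := red_poly_surj (k^-1 *: v).
exists Q; apply/J_red; rewrite red_polyB red_polyM QE.
have -> : red_poly 1 = 1 by rewrite /red_poly rmorph1.
have -> : red_poly P * (k^-1 *: v) - 1 = - (k^-1 *: u) * b.
  have -> : 1 = (k^-1)%:P * (u * b + v * red_poly P).
    by rewrite uvE -polyCM mulVf.
  by rewrite -!mul_polyC; ring.
by apply: J_dvd Jb; rewrite dvdp_mulIr.
Qed.

End ReductionMod.

(** * Localization of a subring at a prime ideal *)

Section Localization.
Variables (K : fieldType) (O : comNzRingType) (j : {rmorphism O -> K}).
Variables (T : subringClosed O) (p : prime_idealr O).

(** The fractions are written with numerator and denominator in [T], although
    the prime lives in the larger ring [O]: for [T = Z[c]] this gives the local
    ring of [Z[c]] at the trace of a prime of the integers. *)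
Definition loc_ring : {pred K} := fun x => `[< exists a b,
  [/\ a \in T, b \in T, b \notin p & x * j b = j a] >].

Definition loc_max : {pred K} := fun x => `[< exists a b,
  [/\ a \in T, b \in T, a \in p, b \notin p & x * j b = j a] >].

Lemma loc_ringP x : reflect
  (exists a b, [/\ a \in T, b \in T, b \notin p & x * j b = j a])
  (x \in loc_ring).
Proof. exact: asboolP. Qed.

Lemma loc_maxP x : reflect
  (exists a b, [/\ a \in T, b \in T, a \in p, b \notin p & x * j b = j a])
  (x \in loc_max).
Proof. exact: asboolP. Qed.

Let notin_mul a b : a \notin p -> b \notin p -> a * b \notin p.
Proof. by rewrite prime_idealrM negb_or => -> ->. Qed.

Let one_notin : 1 \notin p. Proof. by rewrite idealr1. Qed.

Fact loc_ring_subring : subring_closed loc_ring.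
Proof.
split=> [|x y /loc_ringP[a [b [aT bT bp xE]]] /loc_ringP[a' [b' [a'T b'T b'p
  yE]]]
         |x y /loc_ringP[a [b [aT bT bp xE]]] /loc_ringP[a' [b' [a'T b'T b'p
           yE]]]];
  apply/loc_ringP.
- by exists 1, 1; rewrite rpred1 one_notin mul1r.
- exists (a * b' - a' * b), (b * b'); split;
  rewrite ?rpredB ?rpredM ?notin_mul //.
  by rewrite rmorphB !rmorphM /= -xE -yE; ring.
- exists (a * a'), (b * b'); split; rewrite ?rpredM ?notin_mul //.
  by rewrite !rmorphM /= -xE -yE; ring.
Qed.

HB.instance Definition _ :=
  GRing.isSubringClosed.Build K loc_ring loc_ring_subring.

Fact loc_max_zmod : zmod_closed loc_max.
Proof.
split=> [|x y /loc_maxP[a [b [aT bT ap bp xE]]] /loc_maxP[a' [b' [a'T b'T a'p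
  b'p yE]]]];
  apply/loc_maxP.
  by exists 0, 1; rewrite rpred0 rpred1 idealr0 one_notin mul0r rmorph0.
exists (a * b' - a' * b), (b * b').
split; rewrite ?rpredB ?rpredM ?notin_mul //.
- by rewrite mulrC idealMr.
- by rewrite mulrC idealMr.
- by rewrite rmorphB !rmorphM /= -xE -yE; ring.
Qed.

HB.instance Definition _ := GRing.isZmodClosed.Build K loc_max loc_max_zmod.

Lemma loc_ring_base a : a \in T -> j a \in loc_ring.
Proof. by move=> aT; apply/loc_ringP; exists a, 1;
  rewrite rpred1 one_notin rmorph1 mulr1. Qed.

Lemma loc_max_base a : a \in T -> a \in p -> j a \in loc_max.
Proof.
by move=> aT ap; apply/loc_maxP; exists a, 1;
  rewrite rpred1 one_notin rmorph1 mulr1.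
Qed.

Lemma loc_max_sub : {subset loc_max <= loc_ring}.
Proof. by move=> x /loc_maxP[a [b [*]]]; apply/loc_ringP; exists a, b. Qed.

Lemma loc_max_ideal a x : a \in loc_ring -> x \in loc_max -> a * x \in loc_max.
Proof.
move=> /loc_ringP[a1 [b1 [a1T b1T b1p aE]]] /loc_maxP[a2 [b2 [a2T b2T a2p b2p
  xE]]].
apply/loc_maxP; exists (a1 * a2), (b1 * b2).
split; rewrite ?rpredM ?notin_mul ?idealMr //.
by rewrite !rmorphM /= -aE -xE; ring.
Qed.

Lemma loc_ring_inv x : x \in loc_ring -> x \notin loc_max -> x^-1 \in loc_ring.
Proof.
move=> /loc_ringP[a [b [aT bT bp xE]]] xM; have x0 : x != 0.
  by apply: contraNneq xM => ->; apply: rpred0.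
apply/loc_ringP; exists b, a; split=> //;
  last by rewrite -xE mulrA mulVf ?mul1r.
by apply: contra xM => ap; apply/loc_maxP; exists a, b.
Qed.

Hypothesis j_inj : injective j.

Lemma loc_max_mem a : j a \in loc_max -> a \in p.
Proof.
move=> /loc_maxP[a' [b [_ _ a'p bp]]]; rewrite -rmorphM => /j_inj abE.
by move: a'p; rewrite -abE prime_idealrM (negPf bp) orbF.
Qed.

Lemma loc_max1 : 1 \notin loc_max.
Proof. by apply/negP; rewrite -(rmorph1 j) => /loc_max_mem;
  rewrite idealr1. Qed.

End Localization.

(** * The valuation of a local ring with principal maximal ideal *)

Section UniformizerValuation.
Variables (K : fieldType) (A : subringClosed K) (M : zmodClosed K) (pi : K).
Hypotheses (M_sub : {subset M <= A}) (M1 : 1 \notin M).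
Hypothesis M_ideal : forall a x, a \in A -> x \in M -> a * x \in M.
Hypothesis A_inv : forall x, x \in A -> x \notin M -> x^-1 \in A.
Hypotheses (piM : pi \in M) (pi0 : pi != 0).

Definition unit_elt : {pred K} := [pred u | (u \in A) && (u \notin M)].

Lemma unit_eltP u : reflect (u \in A /\ u \notin M) (u \in unit_elt).
Proof. exact: andP. Qed.

Lemma unit_elt_neq0 u : u \in unit_elt -> u != 0.
Proof. by move=> /unit_eltP[_]; apply: contraNneq => ->; rewrite rpred0. Qed.

Lemma unit_eltM u w : u \in unit_elt -> w \in unit_elt -> u * w \in unit_elt.
Proof.
move=> uU wU; have u0 := unit_elt_neq0 uU.
move: uU wU => /unit_eltP[uA uM] /unit_eltP[wA wM]; apply/unit_eltP.
split; first by rewrite rpredM.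
apply: contra wM => uwM; rewrite -[w](mulKf u0).
by rewrite M_ideal // A_inv.
Qed.

Lemma unit_eltV u : u \in unit_elt -> u^-1 \in unit_elt.
Proof.
move=> uU; have u0 := unit_elt_neq0 uU; move: uU => /unit_eltP[uA uM].
apply/unit_eltP; split; first exact: A_inv.
by apply: contra M1 => VuM; rewrite -(mulfV u0) M_ideal.
Qed.

(** Divisors of powers of the uniformizer are again powers of it up to units:
    no chain condition is needed. *)
Lemma divisor_of_power (M_pi : {subset M <= multiple_of A pi}) k x y :
  x \in A -> y \in A -> x * y = pi ^+ k ->
  exists2 u, u \in unit_elt & exists l : int, x = pi ^ l * u.
Proof.
elim: k x y => [|k IH] x y xA yA xyE; have [xM|xM] := boolP (x \in M).
- by move: M1; rewrite -(expr0 pi) -xyE mulrC M_ideal.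
- by exists x; [apply/unit_eltP | exists 0; rewrite expr0z mul1r].
- have /(multipleP pi0)[x' x'A xE] := M_pi _ xM.
  have [|u uU [l x'E]] := IH x' y x'A yA.
    by apply: (mulfI pi0); rewrite mulrA -xE xyE exprS.
  by exists u => //; exists (1 + l); rewrite xE x'E expfzDr // expr1z mulrA.
- by exists x; [apply/unit_eltP | exists 0; rewrite expr0z mul1r].
Qed.

Hypothesis decomp : forall x, x != 0 ->
  exists2 u, u \in unit_elt & exists k : int, x = pi ^ k * u.

Definition unif_val (x : K) : int :=
  xget 0 [set k : int | exists2 u, u \in unit_elt & x = pi ^ k * u]%classic.

Lemma unif_valP x : x != 0 ->
  exists2 u, u \in unit_elt & x = pi ^ unif_val x * u.
Proof.
move=> /decomp[u uU [k xE]]; rewrite /unif_val; case: xgetP => [l _ //|].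
by move=> /(_ k)[]; exists u.
Qed.

Lemma expfz_A (k : int) : 0 <= k -> pi ^ k \in A.
Proof. by case: k => // k _; rewrite -exprnP rpredX ?M_sub. Qed.

Lemma expfz_M (k : int) : 0 < k -> pi ^ k \in M.
Proof.
case: k => [[|k]|] // _; rewrite -exprnP exprSr M_ideal ?rpredX //.
exact: M_sub.
Qed.

Lemma le_unif_val x z (k : int) : x != 0 -> z \in A -> x = pi ^ k * z ->
  k <= unif_val x.
Proof.
move=> x0 zA xE; have [u uU xE'] := unif_valP x0.
rewrite leNgt; apply/negP => lt_k; move/unit_eltP: uU => [_ /negP[]].
have -> : u = z * pi ^ (k - unif_val x).
  apply: (mulfI (expfz_neq0 (unif_val x) pi0)); rewrite -xE' xE.
  by rewrite mulrCA -expfzDr // addrC subrK mulrC.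
by rewrite M_ideal // expfz_M // subr_gt0.
Qed.

Lemma unif_valE x u (k : int) : u \in unit_elt -> x = pi ^ k * u ->
  unif_val x = k.
Proof.
move=> uU xE; have u0 := unit_elt_neq0 uU.
have x0 : x != 0 by rewrite xE mulf_neq0 // expfz_neq0.
have [w wU xE'] := unif_valP x0.
apply/eqP; rewrite eq_le andbC (le_unif_val x0 _ xE) /=; last first.
  by case/unit_eltP: uU.
rewrite leNgt; apply/negP => lt_k; case/unit_eltP: uU => _ /negP[].
have -> : u = w * pi ^ (unif_val x - k).
  apply: (mulfI (expfz_neq0 k pi0)); rewrite -xE {1}xE'.
  by rewrite mulrCA -expfzDr // addrC subrK mulrC.
by rewrite M_ideal ?expfz_M ?subr_gt0 //; case/unit_eltP: wU.
Qed.

Lemma unif_valM x y : x != 0 -> y != 0 ->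
  unif_val (x * y) = unif_val x + unif_val y.
Proof.
move=> x0 y0; have [u uU xE] := unif_valP x0; have [w wU yE] := unif_valP y0.
apply: (unif_valE (unit_eltM uU wU)).
by rewrite {1}xE {1}yE expfzDr // mulrACA.
Qed.

Lemma unif_valV x : x != 0 -> unif_val x^-1 = - unif_val x.
Proof.
move=> x0; have [u uU xE] := unif_valP x0.
apply: (unif_valE (unit_eltV uU)).
by rewrite {1}xE invfM invr_expz.
Qed.

Lemma unif_val_multiple x k : x != 0 ->
  (x \in multiple_of A (pi ^+ k)) = (k%:Z <= unif_val x).
Proof.
move=> x0; apply/idP/idP => [/(multipleP (expf_neq0 k pi0))[z zA xE]|le_k].
  exact: (@le_unif_val x z k x0 zA xE).
have [u /unit_eltP[uA _] xE] := unif_valP x0.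
apply/(multipleP (expf_neq0 k pi0)); exists (pi ^ (unif_val x - k%:Z) * u).
  by rewrite rpredM // expfz_A // subr_ge0.
by rewrite exprnP mulrA -expfzDr // addrC subrK.
Qed.

Lemma unif_val_ge0 x : x != 0 -> (x \in A) = (0 <= unif_val x).
Proof. by move=> x0; rewrite -(unif_val_multiple 0 x0) multipleE expr0 divr1.
  Qed.

Lemma unif_valD x y : x != 0 -> y != 0 -> x + y != 0 ->
  unif_val x <= unif_val (x + y) \/ unif_val y <= unif_val (x + y).
Proof.
wlog le_xy : x y / unif_val x <= unif_val y => [wlog_xy|] x0 y0 xy0.
  have [|/ltW] := leP (unif_val x) (unif_val y); first by move=> le_xy;
    apply: wlog_xy.
  by move=> le_yx; rewrite addrC in xy0 *; apply/or_comm; apply: wlog_xy.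
left; have [u /unit_eltP[uA _] xE] := unif_valP x0.
have [w /unit_eltP[wA _] yE] := unif_valP y0.
apply: (@le_unif_val _ (u + pi ^ (unif_val y - unif_val x) * w)) => //.
  by rewrite rpredD // rpredM // expfz_A // subr_ge0.
rewrite {1}xE {1}yE mulrDr; congr (_ + _).
by rewrite mulrA -expfzDr // addrC subrK.
Qed.

(** Of [x] and [x^-1] one lies in [A], so [A] is integrally closed. *)
Lemma integral_local x : x \in integral_elt -> x \in A.
Proof.
have [->|x0] := eqVneq x 0; first by rewrite (rpred0 A).
move=> /integral_eltP x_int; have [ge0|lt0] := leP 0 (unif_val x).
  by rewrite unif_val_ge0.
apply: integral_mem_inv x_int _.
by rewrite unif_val_ge0 ?invr_eq0 // unif_valV // oppr_ge0 ltW.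
Qed.

End UniformizerValuation.

(** * Powers of an ideal *)

Section IdealExp.
Variables (O : comNzRingType) (p : prime_idealr O).

Local Notation pexp := (ideal_exp [set` p]%classic).

Lemma ideal_expD k x y : pexp k x -> pexp k y -> pexp k (x + y).
Proof.
case: k => // k [u uP ->] [w wP ->]; exists (u ++ w); last by rewrite big_cat.
by move=> y'; rewrite mem_cat => /orP[/uP|/wP].
Qed.

Lemma ideal_expM k a x : pexp k x -> pexp k (a * x).
Proof.
case: k => // k [u uP ->]; exists [seq (a * y.1, y.2) | y <- u].
  move=> _ /mapP[y yu ->] /=; have [y1 y2] := uP _ yu; split=> //.
  exact: idealMr.
by rewrite big_map mulr_sumr; apply: eq_bigr => y _; rewrite mulrA.
Qed.

Lemma ideal_exp_pow k z : z \in p -> pexp k (z ^+ k).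
Proof.
move=> zp; elim: k => // k IH; exists [:: (z, z ^+ k)].
  by move=> y; rewrite mem_seq1 => /eqP ->.
by rewrite big_seq1 exprS.
Qed.

(** The [k]-th power of [1 - b * b'] lies in the [k]-th power of [p] and is [1]
    modulo [b]. *)
Lemma ideal_exp_cancel k b b' y : b * b' - 1 \in p -> pexp k (b * y) -> pexp k
  y.
Proof.
move=> bb'p byp; have [z zE] : exists z, 1 = b * z + (1 - b * b') ^+ k.
  have /eqP := subrXX 1 (1 - b * b') k; rewrite expr1n subr_eq => /eqP {1}->.
  by rewrite opprB addrCA subrr addr0 -mulrA; eexists.
rewrite -[y]mul1r zE mulrDl mulrAC [_ * z]mulrC; apply: ideal_expD.
  exact: ideal_expM.
by rewrite mulrC; apply/ideal_expM/ideal_exp_pow; rewrite -opprB rpredN.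
Qed.

End IdealExp.

(** * Iterates of a unicritical polynomial *)

Section Iterates.
Variables (F : fieldType) (d : nat) (c : F).
Local Notation f := (unicritical d c).

Lemma iter_polyS k : iter_poly f k.+1 = iter_poly f k ^+ d + c%:P.
Proof. by rewrite /iter_poly iterS comp_polyD comp_polyC comp_Xn_poly. Qed.

Lemma iter_poly_add k l : iter_poly f (k + l) = iter_poly f k \Po iter_poly f l.
Proof.
elim: k => [|k IH]; first by rewrite add0n /= comp_polyX.
by rewrite addSn /iter_poly !iterS -!/(iter_poly _ _) IH comp_polyA.
Qed.

Lemma iter_poly_horner0 k : (iter_poly f k).[0] = crit_val d c k.
Proof.
elim: k => [|k IH]; first by rewrite hornerX.
by rewrite iter_polyS hornerD hornerC horner_exp IH.
Qed.

Lemma size_iter_poly k : (1 < d)%N ->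
  size (iter_poly f k) = (d ^ k).+1 /\ iter_poly f k \is monic.
Proof.
move=> d_gt1; elim: k => [|k [IHsz IHm]]; first by rewrite size_polyX monicX.
have sz_exp : size (iter_poly f k ^+ d) = (d ^ k.+1).+1.
  rewrite -[LHS]prednK ?size_exp ?IHsz ?expnSr //.
  by rewrite lt0n size_poly_eq0 monic_neq0 ?monic_exp.
have lt_sz : (size (c%:P) < size (iter_poly f k ^+ d))%N.
  by rewrite sz_exp ltnS (leq_trans (size_polyC_leq1 c)) // expn_gt0 ltnW.
rewrite iter_polyS; split; first by rewrite size_polyDl.
by rewrite monicE lead_coefDl // -monicE monic_exp.
Qed.

(** The [d]-th power map is additive modulo [d]. *)
Lemma iter_poly_mod (S : subringClosed F) k : prime d -> c \in S ->
  exists2 h, h \is a polyOver S &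
    iter_poly f k = 'X^(d ^ k) + (crit_val d c k)%:P + d%:R * h.
Proof.
move=> d_pr cS; elim: k => [|k [h hS IH]].
  by exists 0; rewrite ?rpred0 // mulr0 !addr0 expn0.
have aS : (crit_val d c k)%:P \is a polyOver S.
  by rewrite polyOverC crit_val_mem.
have XS : 'X^(d ^ k) \is a polyOver S by rewrite rpredX ?polyOverX.
have dhS : d%:R * h \is a polyOver S by rewrite rpredM ?rpred_nat.
have [w1 w1S E1] := exprD_prime_mod d_pr (rpredD XS aS) dhS.
have [w2 w2S E2] := exprD_prime_mod d_pr XS aS.
exists (d%:R ^+ d.-1 * h ^+ d + w1 + w2).
  by rewrite !rpredD // rpredM ?rpredX ?rpred_nat.
rewrite iter_polyS IH E1 E2 crit_valS polyCD polyC_exp expnSr exprM exprMn.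
have -> : d%:R ^+ d = d%:R * d%:R ^+ d.-1 :> {poly F}.
  by rewrite -exprS prednK ?prime_gt0.
move: ('X^(d ^ k) ^+ d) ((crit_val d c k)%:P ^+ d) (h ^+ d) (d%:R ^+ d.-1) => X
  a H D.
by ring.
Qed.

(** A factorization of [g] yields one of [g \Po l]. *)
Lemma irreducible_comp (g l : {poly F}) : (1 < size l)%N ->
  irreducible_poly (g \Po l) -> irreducible_poly g.
Proof.
move=> sz_l [sz_gl irr_gl];
  have sz_comp q : (size (q \Po l)).-1 = ((size q).-1 * (size l).-1)%N.
  exact: size_comp_poly.
have g0 : g != 0 by apply: contraTneq sz_gl => ->;
  rewrite comp_poly0 size_poly0.
split=> [|q sz_q q_g].
  rewrite ltnNge; apply: contraL sz_gl => sz_g; rewrite -leqNgt.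
  have := sz_comp g; have -> : (size g).-1 = 0%N by apply/eqP;
    rewrite -subn1 subn_eq0.
  by rewrite mul0n => /eqP; rewrite -subn1 subn_eq0.
have q0 : q != 0 by apply: contraNneq g0 => q0; rewrite q0 dvd0p in q_g.
have /dvdpP[r gE] := q_g.
have ql_gl : (q \Po l) %| (g \Po l) by rewrite gE comp_polyM dvdp_mulIr.
have sz_ql : size (q \Po l) != 1.
  apply: contraNneq sz_q => sz1; have := sz_comp q; rewrite sz1.
  have : (0 < size q)%N by rewrite size_poly_gt0.
  by move: (size q) (size l) sz_l => [|[|a]] // [|[|b]].
have /eqp_size := irr_gl _ sz_ql ql_gl => eq_sz.
rewrite -dvdp_size_eqp //; have := sz_comp q; rewrite eq_sz sz_comp => /eqP.
have q1 : (0 < size q)%N by rewrite size_poly_gt0.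
have g1 : (0 < size g)%N by rewrite size_poly_gt0.
rewrite eqn_pmul2r; last by move: sz_l; clear; case: (size l) => [|[]].
by move: q1 g1; case: (size q) (size g) => [|a] [|b] //= _ _ /eqP->.
Qed.

End Iterates.

(** * The valuation of the local ring of [Z[c]] *)

Section NumberField.
Variables (K : fieldExtType rat) (O : comNzRingType) (j : {rmorphism O -> K}).
Hypotheses (j_inj : injective j) (j_int : forall y, j y \in integral_elt).
Variables (p : prime_idealr O) (cO : O).

Let c : K := j cO.

Hypothesis K_gen : <<1; c>>%VS = fullv.

Let ev : {rmorphism {poly int} -> O} :=
  GRing.RMorphism.clone _ _ (horner_eval cO \o map_poly intr) _.

Let evX : ev 'X = cO.
Proof. by rewrite /= map_polyX /horner_eval hornerX. Qed.

Let evE P : j (ev P) = (map_poly intr P).[c].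
Proof.
rewrite /= /horner_eval -horner_map -map_poly_comp.
by congr (_.[_]); apply: eq_map_poly => z /=; rewrite rmorph_int.
Qed.

Local Notation A := (loc_ring j (rmorph_image ev) p).
Local Notation M := (loc_max j (rmorph_image ev) p).

Let M_sub : {subset M <= A}. Proof. exact: loc_max_sub. Qed.
Let M1 : 1 \notin M. Proof. exact: loc_max1. Qed.
Let M_ideal a x : a \in A -> x \in M -> a * x \in M.
Proof. exact: loc_max_ideal. Qed.
Let A_inv x : x \in A -> x \notin M -> x^-1 \in A.
Proof. exact: loc_ring_inv. Qed.

Let ev_T P : ev P \in rmorph_image ev. Proof. by apply/rmorph_imageP;
  exists P. Qed.
Let ev_A P : j (ev P) \in A. Proof. exact: loc_ring_base. Qed.

Variable d : nat.
Hypotheses (d_prime : prime d) (dp : d%:R \in p).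

Let cA : c \in A. Proof. by rewrite /c -evX ev_A. Qed.

Let dM : d%:R \in M.
Proof. by rewrite -(rmorph_nat j) loc_max_base ?rpred_nat. Qed.

Let intr_neq0 (a : int) : a != 0 -> a%:~R != 0 :> K.
Proof. by rewrite -(rmorph_int (in_alg K)) fmorph_eq0 intr_eq0. Qed.

Let d0 : d%:R != 0 :> K.
Proof. by apply: (@intr_neq0 d%:Z); rewrite -lt0n prime_gt0. Qed.

Let fraction_poly (x : K) : exists P (a : int), a != 0 /\ x * a%:~R = j (ev P).
Proof.
have x_gen : x \in <<1; c>>%VS by rewrite K_gen memvf.
have /polyOver1P[q qE] := Fadjoin_polyOver 1%AS c x.
have := Fadjoin_poly_eq x_gen; rewrite qE => xE.
have [P [a a0 PE]] := rat_poly_scale q.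
exists P, a; split=> //; rewrite evE -xE PE.
rewrite map_polyZ hornerZ -map_poly_comp mulrAC.
have -> : in_alg K a%:~R^-1 * a%:~R = 1.
  by rewrite -(rmorph_int (in_alg K) a) -rmorphM mulVf ?rmorph1 ?intr_eq0.
rewrite mul1r; congr (_.[_]); apply: eq_map_poly => z /=.
exact: (rmorph_int (in_alg K)).
Qed.

Let ev_inv b : b \in rmorph_image ev -> b \notin p -> (j b)^-1 \in A.
Proof.
move=> bT bp; apply: A_inv; first exact: loc_ring_base.
by apply: contra bp => /(loc_max_mem j_inj).
Qed.

Let j_neq0 b : b \notin p -> j b != 0.
Proof.
by apply: contraNneq; rewrite -(rmorph0 j) => /j_inj ->; rewrite idealr0.
Qed.

Let ev_crit i : ev (crit_val d 'X i) = crit_val d cO i.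
Proof. by rewrite crit_val_rmorph evX. Qed.

Let j_crit i : j (crit_val d cO i) = crit_val d c i.
Proof. exact: crit_val_rmorph. Qed.

Section Uniformizer.
Variable r : nat.
Let pi := crit_val d c r.
Hypotheses (r_gt0 : (0 < r)%N) (piM : pi \in M) (pi0 : pi != 0).
Hypotheses (d_pi : d%:R \in multiple_of A pi).
Hypothesis pi_d : exists k, pi ^+ k \in multiple_of A d%:R.

Let piO_p : crit_val d cO r \in p.
Proof. by apply: (loc_max_mem j_inj (T := rmorph_image ev));
  rewrite j_crit. Qed.

Let red_separable : separable_poly (red_poly d (crit_val d 'X r)).
Proof.
rewrite /red_poly crit_val_rmorph /= map_polyX separable_poly.unlock.
rewrite -(prednK r_gt0) deriv_crit_val.
have -> : d%:R = 0 :> {poly 'F_d} by rewrite -polyC_natr pchar_Fp_0.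
by rewrite mul0r addr0 coprimep1.
Qed.

Let gp : ev (crit_val d 'X r) \in p. Proof. by rewrite ev_crit. Qed.

(* As [d] is a multiple of [pi], it is enough to work modulo [d], where [a_r] is
   separable. *)
Let M_pi : {subset M <= multiple_of A pi}.
Proof.
move=> x /loc_maxP[_ [b [/rmorph_imageP[P ->] bT Pp bp xE]]].
have [S [Q [R [Sp SPE]]]] := local_generator d_prime dp red_separable gp Pp.
have SbT : b * ev S \in rmorph_image ev by rewrite rpredM.
have Sbp : b * ev S \notin p by rewrite prime_idealrM negb_or bp.
have -> : x = (pi * j (ev Q) + d%:R * j (ev R)) * (j (b * ev S))^-1.
  apply: (mulIf (j_neq0 Sbp)); rewrite mulfVK ?j_neq0 // rmorphM mulrA xE mulrC.
  rewrite -!rmorphM SPE rmorphD !rmorphM ev_crit rmorphD !rmorphM j_crit.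
  by rewrite !rmorph_nat.
rewrite multiple_mulr ?ev_inv // rpredD // multiple_mulr ?ev_A //.
exact: multiple_refl.
Qed.

(* The part of [a] prime to [d] is a unit, and [d] divides a power of [pi]. *)
Let int_divides (a : int) : a != 0 ->
  exists2 w, w \in A & exists k, a%:~R * w = pi ^+ k.
Proof.
move=> a0; have a_gt0 : (0 < `|a|)%N by rewrite absz_gt0.
have [b cop_bd aE] := pfactor_coprime d_prime a_gt0; set e := logn d `|a| in aE.
have [k /(multipleP d0)[z zA kE]] := pi_d.
have bA : b%:R \in A by rewrite rpred_nat.
have bM : b%:R \notin M.
  have /coprimezP[[u w] /= uw] : coprimez d%:Z b%:Z by rewrite coprimezE.
  apply: contra M1 => bM.
  have -> : 1 = u%:~R * d%:R + w%:~R * b%:R :> K.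
    by rewrite -[LHS]/(1%:~R) -uw intrD !intrM.
  by rewrite rpredD // M_ideal ?rpred_int.
have b0 : b%:R != 0 :> K by apply: contraNneq bM => ->; rewrite rpred0.
exists ((-1) ^+ (a < 0)%R * (z ^+ e * b%:R^-1)).
  by rewrite rpredM ?rpredX ?rpredN ?rpred1 // rpredM ?rpredX ?A_inv.
exists (k * e)%N; rewrite {1}[a]intEsign aE exprM kE exprMn.
rewrite intrM rmorph_sign PoszM intrM -!pmulrn natrX.
rewrite mulrACA -expr2 sqrr_sign mul1r.
by field.
Qed.

(* Both a nonzero element of [Z[c]] and an integral denominator divide nonzero
   integers in [Z[c]], hence powers of [pi]. *)
Let decomp x : x != 0 ->
  exists2 u, u \in unit_elt A M & exists k : int, x = pi ^ k * u.
Proof.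
move=> x0; have [P [a [a0 xE]]] := fraction_poly x.
have y0 : j (ev P) != 0 by rewrite -xE mulf_neq0 ?intr_neq0.
have [P' [a' [a'0 VyE]]] := fraction_poly (j (ev P))^-1.
have [w wA [k wE]] := int_divides a0; have [w' w'A [k' w'E]] := int_divides a'0.
have dop := divisor_of_power M1 M_ideal pi0 M_pi.
have [u uU [l uE]] := dop k _ _ (rpred_int A a) wA wE.
have [|u' u'U [l' u'E]] := dop k' (j (ev P)) (j (ev P') * w') (ev_A P) (rpredM
  (ev_A P') w'A).
  by rewrite -VyE mulrA mulVKf.
have u0 := unit_elt_neq0 uU.
exists (u' * u^-1); first by apply: (unit_eltM M_ideal A_inv) => //;
  apply: (unit_eltV M1 M_ideal A_inv).
exists (l' - l); apply: (mulIf (intr_neq0 a0)); rewrite xE u'E uE.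
rewrite expfzDr // -invr_expz; field.
by rewrite u0 expfz_neq0.
Qed.

Local Notation v := (unif_val A M pi).

Let j_A y : j y \in A.
Proof. by apply: (integral_local M_sub M1 M_ideal A_inv piM pi0 decomp);
  apply: j_int. Qed.

Let j_M y : y \in p -> j y \in M.
Proof.
move=> yp; apply: contraT => yM; have := A_inv (j_A y) yM.
case/loc_ringP => a [b [_ _ bp]]; have y0 : j y != 0.
  by apply: contraNneq yM => ->; rewrite rpred0.
move/(congr1 (GRing.mul (j y))); rewrite mulVKf // -rmorphM => /j_inj bE.
by move: bp; rewrite bE mulrC idealMr.
Qed.

Local Notation pexp := (ideal_exp [set` p]%classic).

Lemma ideal_exp_multiple k y : pexp k y -> j y \in multiple_of A (pi ^+ k).
Proof.
elim: k y => [|k IH] y; first by rewrite multipleE expr0 divr1.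
move=> [u uP ->]; rewrite rmorph_sum big_seq rpred_sum // => z /uP[z1 z2].
rewrite rmorphM multipleE exprS invfM mulrACA.
by rewrite rpredM // -multipleE ?IH // M_pi ?j_M.
Qed.

Lemma multiple_ideal_exp k y : j y \in multiple_of A (pi ^+ k) -> pexp k y.
Proof.
move=> /(multipleP (expf_neq0 k pi0))[z /loc_ringP[a [b [_ /rmorph_imageP[P ->]
  bp zE]]] yE].
have [Q QE] := inverse_mod d_prime dp red_separable gp bp.
apply: (@ideal_exp_cancel _ _ _ (ev P) (ev Q)).
  by rewrite -rmorphM -(rmorph1 ev) -rmorphB.
have -> : ev P * y = a * crit_val d cO r ^+ k.
  by apply: j_inj; rewrite !rmorphM rmorphXn j_crit yE -zE /pi; ring.
exact/ideal_expM/ideal_exp_pow.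
Qed.

(** Powers of [p] and the valuation of the local ring of [Z[c]] agree, although
    [p] is an ideal of the full ring of integers. *)
Lemma ord_unif_val k y : ideal_ord [set` p]%classic y k ->
  j y != 0 /\ v (j y) = k%:Z.
Proof.
move=> [yk yk1]; have y0 : j y != 0.
  apply/eqP => y0; apply: yk1; apply: multiple_ideal_exp.
  by rewrite y0 rpred0.
have vmul l := unif_val_multiple M_sub M_ideal piM pi0 decomp l y0.
split=> //; apply/eqP; rewrite eq_le -vmul ideal_exp_multiple // andbT.
rewrite leNgt; apply/negP => lt_k; apply: yk1; apply: multiple_ideal_exp.
by rewrite vmul intS lez1D.
Qed.

Lemma ord_diff_multiple x y i k : ideal_ord [set` p]%classic x i ->
  ideal_ord [set` p]%classic y k -> 2 <= i%:Z - k%:Z ->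
  j x / j y \in multiple_of A (pi ^+ 2).
Proof.
move=> /ord_unif_val[x0 <-] /ord_unif_val[y0 <-] le2.
rewrite (unif_val_multiple M_sub M_ideal piM pi0 decomp) ?mulf_neq0 ?invr_neq0
  //.
rewrite (unif_valM M_sub M_ideal A_inv piM pi0 decomp) ?invr_neq0 //.
by rewrite (unif_valV M_sub M1 M_ideal A_inv piM pi0 decomp).
Qed.

(** The constant term [a_l - alpha] is a uniformizer, and the coefficients of
    degree between [0] and [d ^ l] are multiples of [d], hence of [pi]. *)
Lemma iterate_eisenstein l alpha : (0 < l)%N ->
  alpha \in multiple_of A (pi ^+ 2) ->
  (exists2 z, z \in M & crit_val d c l = pi * (1 + z)) ->
  irreducible_poly (iter_poly (unicritical d c) l - alpha%:P).
Proof.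
move=> l_gt0 /(multipleP (expf_neq0 2 pi0))[t tA alphaE] [z zM lE].
have d_gt1 := prime_gt1 d_prime.
have [sz_f f_monic] := size_iter_poly c l d_gt1.
have D_gt0 : (0 < d ^ l)%N by rewrite expn_gt0 ltnW.
have lt_sz : (size (- alpha%:P) < size (iter_poly (unicritical d c) l))%N.
  by rewrite sz_f size_polyN ltnS (leq_trans (size_polyC_leq1 _)).
have coef0E : (iter_poly (unicritical d c) l - alpha%:P)`_0 = pi * (1 + (z - pi
  * t)).
  rewrite coefB coefC /= -horner_coef0 iter_poly_horner0 lE alphaE; ring.
have ztM : z - pi * t \in M by rewrite rpredB // mulrC M_ideal.
have ztU : 1 + (z - pi * t) \in unit_elt A M.
  by apply/unit_eltP; apply: unit_1D.
apply: (@eisenstein_irreducible _ v _ _ (d ^ l)) => //.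
- exact: (unif_valM M_sub M_ideal A_inv piM pi0 decomp).
- exact: (unif_valD M_sub M_ideal piM pi0 decomp).
- by rewrite size_polyDl.
- by rewrite monicE lead_coefDl // -monicE.
- by rewrite coef0E mulf_neq0 // (unit_elt_neq0 ztU).
- by apply: (unif_valE M_sub M_ideal piM pi0 decomp ztU); rewrite coef0E expr1z.
move=> k /andP[k_gt0 lt_k] k0.
rewrite -(unif_val_multiple M_sub M_ideal piM pi0 decomp 1 k0) expr1.
have [h hA ->] := iter_poly_mod l d_prime cA.
rewrite !coefD coefXn coefN !coefC.
rewrite (ltn_eqF lt_k) (gtn_eqF k_gt0) oppr0 !add0r addr0 mulr_natl coefMn.
by rewrite -mulr_natl multiple_mulr // (polyOverP hA).
Qed.

End Uniformizer.

(** The iterates whose order is a multiple of the residual period [r] are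
    irreducible by Eisenstein's criterion, and every iterate is a left factor of
    one of them. *)
Theorem stable_preperiodic (s n : nat) (alpha : K) : (0 < n)%N ->
  crit_val d c (s + n).+1 ^+ d = crit_val d c s.+1 ^+ d ->
  crit_val d c (s + n).+1 != crit_val d c s.+1 ->
  alpha = 0 \/ (exists x y i k, [/\ alpha = j x / j y,
    ideal_ord [set` p]%classic x i, ideal_ord [set` p]%classic y k &
    2 <= i%:Z - k%:Z]) ->
  stable (unicritical d c) alpha.
Proof.
move=> n_gt0 eq_pow neq_val alphaE.
have [r [[r_gt0 rM r0] [_ d_r r_d mul_r]]] :=
  local_uniformizer M_sub M1 M_ideal A_inv d_prime dM cA n_gt0 eq_pow neq_val.
have alpha_mul : alpha \in multiple_of A (crit_val d c r ^+ 2).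
  case: alphaE => [->|[x [y [i [k [-> xi yk le2]]]]]]; first by rewrite rpred0.
  exact: (ord_diff_multiple r_gt0 rM r0 d_r r_d xi yk le2).
move=> k k_gt0.
pose l := (r * k.-1.+1 - k)%N.
have kl : (k + l = r * k.-1.+1)%N.
  by rewrite subnKC // prednK // leq_pmull.
have irr : irreducible_poly (iter_poly (unicritical d c) (k + l) - alpha%:P).
  rewrite kl; apply: (iterate_eisenstein r_gt0 rM r0 d_r r_d) => //.
  by rewrite muln_gt0 r_gt0.
apply: (@irreducible_comp _ _ (iter_poly (unicritical d c) l)).
  by rewrite (size_iter_poly c l (prime_gt1 d_prime)).1 ltnS expn_gt0 prime_gt0.
by rewrite comp_polyB comp_polyC -iter_poly_add.
Qed.

End NumberField.

Theorem theorem1p3 (R : realType) (d m n : nat) (zeta c0 : R[i])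
    (d_prime : prime d)
    (zeta_root : zeta ^+ d = 1) (zeta_neq1 : zeta != 1)
    (m_ge2 : (2 <= m)%N) (n_ge1 : (1 <= n)%N)
    (c0_root : root (misiurewicz_poly d m n zeta) c0)
    (* K, embedded in the complex numbers by iota, is Q(c0), generated by c. *)
    (K : fieldExtType rat) (iota : {rmorphism K -> R[i]}) (c : K)
    (iota_c : iota c = c0) (K_gen : <<1; c>>%VS = fullv)
    (alpha : K) (p : prime_idealr (ring_of_integers K))
    (p_above_d : d%:R \in p)
    (val_alpha : (2%:E <= valuation p alpha)%E) :
  stable (unicritical d c) alpha.
Proof.
case: m m_ge2 c0_root => [|[|s]] // _ c0_root.
have [c0_eq c0_neq0] :=
  misiurewicz_poly_root d_prime zeta_root zeta_neq1 n_ge1 c0_root.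
have iotaE k : crit_val d c0 k = iota (crit_val d c k).
  by rewrite crit_val_rmorph iota_c.
have eq_pow : crit_val d c (s + n).+1 ^+ d = crit_val d c s.+1 ^+ d.
  have iotaX k : iota (crit_val d c k ^+ d) = crit_val d c0 k ^+ d.
    by rewrite iotaE rmorphXn.
  apply: (fmorph_inj iota); apply: etrans (iotaX _) (etrans _ (esym (iotaX _))).
  by rewrite c0_eq exprMn zeta_root mul1r.
have neq_val : crit_val d c (s + n).+1 != crit_val d c s.+1.
  apply: contraNneq zeta_neq1 => /(congr1 iota); rewrite -!iotaE c0_eq => e.
  by apply/eqP/(mulIf c0_neq0); rewrite e mul1r.
have c_int : c \in algebraic_integer (K := K).
  apply/asboolP/integral_eltP.
  apply: (preperiodic_integral (i := s.+2) (prime_gt1 d_prime) n_ge1).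
  by rewrite addSn addSn [LHS]crit_valS [RHS]crit_valS eq_pow.
pose cO : ring_of_integers K := Sub c c_int.
pose j : {rmorphism ring_of_integers K -> K} :=
  GRing.RMorphism.clone _ _ (val : ring_of_integers K -> K) _.
have j_int y : j y \in integral_elt.
  by have /asboolP := valP y => y_int; apply/integral_eltP.
apply: (@stable_preperiodic K _ j val_inj j_int p cO K_gen d d_prime p_above_d s n).
all: rewrite //=.
have [->|alpha0] := eqVneq alpha 0; [by left | right].
move: val_alpha; rewrite /valuation (negPf alpha0).
case: xgetP => [e eE [x [y [i [k [alphaE xi yk ->]]]]] le2|_].
  by exists x, y, i, k; split=> //; move: le2; rewrite lee_fin.
by rewrite lee_fin.
Qed.
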